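(* Let $X$ be a Banach space and let $\{\mathfrak{s}_n : n\in\omega\}$ be a countable family of projectional skeletons on $X$ inducing the same set $D\subset X^*$ (that is, $D(\mathfrak{s}_n)=D$ for every $n\in\omega$). Then there exists a simple projectional skeleton on $X$ which is isomorphic to a subskeleton of $\mathfrak{s}_n$, for every $n\in\omega$. Moreover, for every countable set $S$ and every finite list of formulas $\Phi$, there exists a family $\mathcal{M}$ consisting of countable suitable models for $\Phi$ and $S$ such that every $M\in\mathcal{M}$ admits canonical projection $P_M$ associated to $X$ and $D$, and if $\mathcal{M}$ is ordered by inclusion, then the following holds: (1) $\mathcal{F}=\{X_M : M\in\mathcal{M}\}$ is a rich family and, if we set $P_F:=P_M$ whenever $F=X_M$ with $M\in\mathcal{M}$, then $(P_F)_{F\in\mathcal{F}}$ is a simple projectional skeleton on $X$ isomorphic to $(P_M)_{M\in\mathcal{M}}$, via the order-isomorphism $\mathcal{M}\ni M\longmapsto X_M\in\mathcal{F}$. (2) $(P_M)_{M\in\mathcal{M}}$ is isomorphic to a subskeleton of $\mathfrak{s}_n$, for every $n\in\omega$.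
   Context: Suitable models: formulas are formulas in the language of ZFC set theory. For a set $M$ and a formula $\phi$, $\phi^M$ is obtained from $\phi$ by replacing each quantifier $\exists x$ by $\exists x\in M$ and each $\forall x$ by $\forall x\in M$. A formula $\phi(x_1,\dots,x_n)$ with all free variables shown is absolute for $M$ if for all $a_1,\dots,a_n\in M$: $\phi^M(a_1,\dots,a_n)\leftrightarrow\phi(a_1,\dots,a_n)$. For a finite list of formulas $\Phi$ and a set $S$, $M$ is a suitable model for $\Phi$ and $S$, written $M\prec(\Phi;S)$, if $S\subset M$ and every formula of $\Phi$ is absolute for $M$. For a topological space $X$ and a set $M$, $X_M:=\overline{X\cap M}$. Canonical projection: for a set $D\subset X^*$, $(D\cap M)_\perp=\{x\in X : d(x)=0\ \forall d\in D\cap M\}$. $M$ admits canonical projection $P_M$ associated to $X$ and $D$ if there is a (necessarily unique) bounded linear projection $P_M$ on $X$ with $P_M[X]=X_M$ and $\ker P_M=(D\cap M)_\perp$. (A set $D$ induced by a projectional skeleton is a $C$-norming subspace of $X^*$ for some $C\ge1$.) Projectional skeletons: Let $(\Gamma,\le)$ be an up-directed partially ordered set. A sequence $(s_n)_{n\in\omega}$ in $\Gamma$ is increasing if $s_n\le s_{n+1}$ for all $n$. $\Gamma$ is $\sigma$-complete if every increasing sequence in $\Gamma$ has a supremum in $\Gamma$; then $\Gamma'\subset\Gamma$ is $\sigma$-closed in $\Gamma$ if $\sup_n s_n\in\Gamma'$ for every increasing sequence $(s_n)$ in $\Gamma'$. A projectional skeleton on $X$ is a family of bounded linear projections $\mathfrak{s}=(P_s)_{s\in\Gamma}$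 on $X$ indexed by an up-directed $\sigma$-complete partially ordered set $\Gamma$ such that: (1) $P_s[X]$ is separable for every $s$; (2) if $s\le t$ then $P_s=P_s\circ P_t=P_t\circ P_s$; (3) if $(s_n)$ is increasing with $s=\sup_n s_n$, then $P_s[X]=\overline{\bigcup_n P_{s_n}[X]}$; (4) $X=\bigcup_{s\in\Gamma}P_s[X]$. The set induced by $\mathfrak{s}$ is $D(\mathfrak{s}):=\bigcup_{s\in\Gamma}P_s^*[X^*]$. $(P_s)_{s\in\Gamma'}$ is a (projectional) subskeleton of $(P_s)_{s\in\Gamma}$ if $\Gamma'$ is a $\sigma$-closed subset of $\Gamma$ and $(P_s)_{s\in\Gamma'}$ is a projectional skeleton on $X$. Projectional skeletons $(Q_\lambda)_{\lambda\in\Lambda}$ and $(P_s)_{s\in\Gamma}$ on $X$ are isomorphic if there is an order-isomorphism $\phi:\Lambda\to\Gamma$ (a bijection with $\phi(s)\le\phi(t)$ iff $s\le t$) such that $Q_\lambda=P_{\phi(\lambda)}$ for every $\lambda\in\Lambda$. A family $\mathcal{F}$ of closed separable subspaces of $X$ is rich if each closed separable subspace of $X$ is contained in an element of $\mathcal{F}$, and $\overline{\bigcup_n F_n}\in\mathcal{F}$ for every increasing sequence $(F_n)_{n\in\omega}$ in $\mathcal{F}$. A simple projectional skeleton on $X$ is a family of projections $(P_F)_{F\in\mathcal{F}}$ on $X$ indexed by a rich family $\mathcal{F}$ ordered by inclusion such that $P_F[X]=F$ for every $F\in\mathcal{F}$, and $P_E=P_E\circ P_F=P_F\circ P_E$ whenever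 $E\subset F$ in $\mathcal{F}$. *)

(* Defs.v *)
From HB Require Import structures.
From mathcomp Require Import all_boot all_order all_algebra.
From mathcomp Require Import all_classical all_reals all_analysis.
From mathcomp Require Import complex.

Set Implicit Arguments.
Unset Strict Implicit.
Unset Printing Implicit Defensive.

Import Order.TTheory GRing.Theory Num.Theory.
Import numFieldNormedType.Exports.

Local Open Scope classical_set_scope.
Local Open Scope ring_scope.

(* The universe of sets: Aczel's well-founded trees modulo bisimulation.      *)
(* It is transitive, well-founded and extensional, and every family of sets   *)
(* indexed by a type in the universe of [A] below is a set ([zmem_zset_fam],  *)
(* [set_extensionality], [set_induction]); classically and with choice this   *)
(* makes it a model of ZFC.  Every type in the universe of [A] injects into   *)
(* it ([small_set_coding]).                                                   *)

Inductive tree : Type := Node (A : Type) (f : A -> tree).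

Fixpoint bisim (x y : tree) : Prop :=
  match x, y with
  | Node A f, Node B g =>
      (forall a, exists b, bisim (f a) (g b)) /\
      (forall b, exists a, bisim (f a) (g b))
  end.

Lemma bisim_refl x : bisim x x.
Proof. by elim: x => A f IH /=; split=> a; exists a. Qed.

Lemma bisim_sym x y : bisim x y -> bisim y x.
Proof.
elim: x y => A f IH [B g] /= [H1 H2]; split.
- by move=> b; have [a /IH ?] := H2 b; exists a.
- by move=> a; have [b /IH ?] := H1 a; exists b.
Qed.

Lemma bisim_trans x y z : bisim x y -> bisim y z -> bisim x z.
Proof.
elim: x y z => A f IH [B g] [C h] /= [H1 H2] [H3 H4]; split.
- by move=> a; have [b Hb] := H1 a; have [c Hc] := H3 b; exists c; apply: IH Hc.
- by move=> c; have [b Hb] := H4 c; have [a Ha] := H2 b; exists a; apply: IH Hb.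
Qed.

Record zset : Type := ZSet {
  zclass :> set tree ;
  zclassP : exists x, zclass = bisim x }.

Definition zset_of (x : tree) : zset :=
  @ZSet (bisim x) (ex_intro _ x erefl).

Definition zrepr (x : zset) : tree := projT1 (cid (zclassP x)).

Lemma zset_ofK (x : zset) : zset_of (zrepr x) = x.
Proof.
case: x => c p; rewrite /zrepr /=; case: cid => x /= e; subst c.
by congr ZSet; exact: Prop_irrelevance.
Qed.

Lemma zset_of_eq x y : zset_of x = zset_of y <-> bisim x y.
Proof.
split=> [[e]|h].
  by rewrite e; exact: bisim_refl.
suff e : bisim x = bisim y.
  rewrite /zset_of; move: (ex_intro _ x _) (ex_intro _ y _); rewrite e => p q.
  by congr ZSet; exact: Prop_irrelevance.
apply/funext => z; apply/propext; split; last exact: bisim_trans.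
exact/bisim_trans/bisim_sym.
Qed.

Definition zmem (x y : zset) : Prop :=
  let: Node A f := zrepr y in exists a : A, x = zset_of (f a).

Definition zset_fam (A : Type) (f : A -> zset) : zset :=
  zset_of (Node (fun a => zrepr (f a))).

Definition elts (y : zset) : set zset := [set x | zmem x y].

Lemma zmem_zset_of (x : zset) A (f : A -> tree) :
  zmem x (zset_of (Node f)) <-> exists a, x = zset_of (f a).
Proof.
rewrite /zmem.
have : bisim (zrepr (zset_of (Node f))) (Node f).
  by apply/zset_of_eq; rewrite zset_ofK.
case: (zrepr _) => B g /= [H1 H2]; split=> -[i ->].
- by have [j /zset_of_eq ->] := H1 i; exists j.
- by have [j /zset_of_eq <-] := H2 i; exists j.
Qed.

Lemma zmem_zset_fam (A : Type) (f : A -> zset) x :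
  zmem x (zset_fam f) <-> exists a, x = f a.
Proof.
by rewrite zmem_zset_of; split=> -[a ->]; exists a; rewrite zset_ofK.
Qed.

Lemma set_extensionality x y : (forall z, zmem z x <-> zmem z y) -> x = y.
Proof.
rewrite -(zset_ofK x) -(zset_ofK y); case: (zrepr x) (zrepr y) => A f [B g] H.
apply/zset_of_eq => /=; split=> [a|b].
- have /H/zmem_zset_of[b /zset_of_eq ?] : zmem (zset_of (f a)) (zset_of (Node f)).
    by apply/zmem_zset_of; exists a.
  by exists b.
- have /H/zmem_zset_of[a /zset_of_eq ?] : zmem (zset_of (g b)) (zset_of (Node g)).
    by apply/zmem_zset_of; exists b.
  by exists a; exact: bisim_sym.
Qed.

Lemma set_induction (P : zset -> Prop) :
  (forall y, (forall x, zmem x y -> P x) -> P y) -> forall y, P y.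
Proof.
move=> H y; rewrite -(zset_ofK y); elim: (zrepr y) => A f IH.
by apply: H => x /zmem_zset_of[a ->].
Qed.

Lemma small_injection (A : Type) : exists c : A -> zset, injective c.
Proof.
pose T : eqType := {classic A}.
have [R woR] := wochoice.well_ordering_principle T.
pose lt (a b : T) := R a b && (a != b).
have le_min (B : {pred T}) b : b \in B ->
    exists2 m, m \in B & forall x, x \in B -> R m x.
  by move=> Bb; have [|m [[Bm lbm] _]] := woR B; [exists b | exists m].
have trich a b : a != b -> lt a b \/ lt b a.
  move=> neq_ab; have [|m] := le_min (pred2 a b) a; first by rewrite !inE eqxx.
  rewrite !inE => /orP[]/eqP-> /= lem; [left|right]; apply/andP; split=> //.
  - by apply: lem; rewrite !inE eqxx orbT.
  - by apply: lem; rewrite !inE eqxx.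
  - by rewrite eq_sym.
have anti a b : R a b -> R b a -> a = b.
  move=> Rab Rba; have [|m [_ m_uniq]] := woR (pred2 a b).
    by exists a; rewrite !inE eqxx.
  have refl x : R x x.
    have [|y /eqP <-] := le_min (pred1 x) x; first by rewrite inE.
    by apply; rewrite inE.
  have min x : x \in pred2 a b -> R x a -> R x b -> m = x.
    by move=> xab xa xb; apply: m_uniq; split=> // y /orP[] /eqP->.
  by rewrite -(min a) ?(min b) ?inE ?eqxx ?orbT.
have wf_lt : well_founded lt.
  move=> a; apply: contrapT => nacc.
  pose B : {pred T} := [pred x | `[< ~ Acc lt x >]].
  have [|m /asboolP Bm lem] := le_min B a; first exact/asboolP.
  apply: Bm; constructor=> b /andP[Rbm neq_bm]; apply: contrapT => Bb.
  by move/negP: neq_bm; apply; apply/eqP/anti => //; apply: lem; exact/asboolP.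
pose ltA (a b : A) : Prop := lt a b.
have {}wf_lt : well_founded ltA := wf_lt.
pose F (a : A) (c : forall b, ltA b a -> zset) : zset :=
  zset_fam (fun u : {b : A | ltA b a} => c (sval u) (svalP u)).
pose c : A -> zset := Fix wf_lt (fun=> zset) F.
have cE a : c a = zset_fam (fun u : {b : A | ltA b a} => c (sval u)).
  rewrite /c Fix_eq // => x f g fg; rewrite /F; congr zset_fam.
  by apply/funext => u; exact: fg.
have mem_c a b : ltA a b -> zmem (c a) (c b).
  by move=> ab; rewrite (cE b); apply/zmem_zset_fam; exists (exist _ a ab).
have irrefl : forall x, ~ zmem x x.
  by elim/set_induction => x IH xx; exact: (IH x xx xx).
exists c => a b cab; apply: contrapT => neq_ab.
have /trich : (a : T) != (b : T) by exact/eqP.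
by case=> /mem_c; rewrite cab => /irrefl.
Qed.

(* [T] may live in a larger universe than the index types of [tree], so it    *)
(* has to be presented as a set of the universe.                              *)
Record set_coding (T : Type) : Type := SetCoding {
  code :> T -> zset ;
  carrier : zset ;
  code_inj : injective code ;
  carrierE : elts carrier = range code }.

Lemma small_set_coding (A : Type) : inhabited (set_coding A).
Proof.
have [c c_inj] := small_injection A.
have cE : elts (zset_fam c) = range c.
  apply/seteqP; split=> x; first by case/zmem_zset_fam=> a ->; exists a.
  by move=> [a _ <-]; apply/zmem_zset_fam; exists a.
by constructor; exact: SetCoding c_inj cE.
Qed.

Lemma replacement (T : Type) (c : set_coding T) (F : T -> zset) :
  exists y, elts y = range F.
Proof.
have := carrierE c; rewrite -(zset_ofK (carrier c)).
case: (zrepr _) => A f cE.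
have /choice[h hE] (a : A) : exists t, c t = zset_of (f a).
  have : elts (zset_of (Node f)) (zset_of (f a)).
    by apply/zmem_zset_of; exists a.
  by rewrite cE => -[t _ <-]; exists t.
exists (zset_fam (F \o h)); apply/seteqP; split=> x.
  by case/zmem_zset_fam=> a ->; exists (h a).
move=> [t _ <-]; apply/zmem_zset_fam.
have : range c (c t) by exists t.
rewrite -cE => /zmem_zset_of[a]; rewrite -hE => e.
by exists a; rewrite /= -(code_inj e).
Qed.

Definition replace (T : Type) (c : set_coding T) (F : T -> zset) : zset :=
  projT1 (cid (replacement c F)).

Lemma elts_replace (T : Type) (c : set_coding T) (F : T -> zset) :
  elts (replace c F) = range F.
Proof. exact: projT2 (cid (replacement c F)). Qed.

Definition unordered_pair (x y : zset) : zset :=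
  zset_fam (fun b : bool => if b then x else y).

Definition ordered_pair (x y : zset) : zset :=
  unordered_pair (unordered_pair x x) (unordered_pair x y).

Definition included (x y : zset) : Prop := elts x `<=` elts y.

(* Variables are named by natural numbers: [Eq i j] is v_i = v_j, [In i j] is  *)
(* v_i in v_j, and [Ex i p], [All i p] bind v_i.                              *)

Inductive formula : Type :=
| Eq of nat & nat
| In of nat & nat
| Not of formula
| And of formula & formula
| Or of formula & formula
| Imp of formula & formula
| Iff of formula & formula
| Ex of nat & formula
| All of nat & formula.

Lemma formula_comparable : comparable formula.
Proof. by rewrite /comparable /decidable; do 2! decide equality. Qed.

HB.instance Definition _ := comparableMixin formula_comparable.

Fixpoint free_vars (phi : formula) : seq nat :=
  match phi with
  | Eq i j | In i j => [:: i; j]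
  | Not p => free_vars p
  | And p q | Or p q | Imp p q | Iff p q => free_vars p ++ free_vars q
  | Ex i p | All i p => [seq j <- free_vars p | j != i]
  end.

Definition update (e : nat -> zset) (i : nat) (a : zset) : nat -> zset :=
  fun j => if j == i then a else e j.

(* The truth value of [phi] under the assignment [e], each quantifier being   *)
(* replaced by the corresponding quantifier bounded by the class [Q].         *)
Fixpoint holds_in (Q : set zset) (e : nat -> zset) (phi : formula) : Prop :=
  match phi with
  | Eq i j => e i = e j
  | In i j => zmem (e i) (e j)
  | Not p => ~ holds_in Q e p
  | And p q => holds_in Q e p /\ holds_in Q e q
  | Or p q => holds_in Q e p \/ holds_in Q e q
  | Imp p q => holds_in Q e p -> holds_in Q e q
  | Iff p q => holds_in Q e p <-> holds_in Q e q
  | Ex i p => exists a, Q a /\ holds_in Q (update e i a) p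
  | All i p => forall a, Q a -> holds_in Q (update e i a) p
  end.

Definition absolute (M : zset) (phi : formula) : Prop :=
  forall e : nat -> zset, (forall i, i \in free_vars phi -> zmem (e i) M) ->
    (holds_in (elts M) e phi <-> holds_in setT e phi).

Definition suitable_model (Phi : seq formula) (S M : zset) : Prop :=
  included S M /\ forall phi, phi \in Phi -> absolute M phi.

Section Order.
Context {I : Type}.
Implicit Types (G : set I) (le : I -> I -> Prop) (s : nat -> I).

Definition partially_ordered G le :=
  [/\ forall i, G i -> le i i,
      forall i j, G i -> G j -> le i j -> le j i -> i = j &
      forall i j k, G i -> G j -> G k -> le i j -> le j k -> le i k].

Definition up_directed G le :=
  forall i j, G i -> G j -> exists k, [/\ G k, le i k & le j k].

Definition increasing G le s :=
  (forall n, G (s n)) /\ (forall n, le (s n) (s n.+1)).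

Definition supremum G le s (u : I) :=
  [/\ G u, forall n, le (s n) u &
      forall v, G v -> (forall n, le (s n) v) -> le u v].

Definition sigma_complete G le :=
  forall s, increasing G le s -> exists u, supremum G le s u.

Definition sigma_closed G le (G' : set I) :=
  G' `<=` G /\
  forall s u, increasing G' le s -> supremum G le s u -> G' u.

End Order.

Definition real_or_complex (K : numFieldType) : Prop :=
  (exists R : realType, K = (R : numFieldType)) \/
  (exists R : realType, K = (R[i] : numFieldType)).

Record operator_family {K : numFieldType} (X : normedModType K) : Type :=
  OperatorFamily {
    idx : Type ;
    dom : set idx ;
    ord_rel : idx -> idx -> Prop ;
    op : idx -> X -> X }.

Arguments dom {K X} o _.
Arguments ord_rel {K X} o _ _.
Arguments op {K X} o _ _.

Section Banach.
Context {K : numFieldType}.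

Definition bounded_linear (X Y : normedModType K) (f : X -> Y) : Prop :=
  linear f /\ exists C : K, forall x, `|f x| <= C * `|x|.

Variable X : completeNormedModType K.

Definition dual_space : set (X -> K^o) := [set d | bounded_linear d].

Definition projection (P : X -> X) : Prop :=
  bounded_linear P /\ forall x, P (P x) = P x.

Definition separable (F : set X) : Prop :=
  exists A : set X, [/\ countable A, A `<=` F & F `<=` closure A].

Definition subspace (F : set X) : Prop :=
  F 0 /\ forall (a : K) x y, F x -> F y -> F (a *: x + y).

Definition closed_separable_subspace (F : set X) : Prop :=
  [/\ closed F, separable F & subspace F].

Definition projectional_skeleton (s : operator_family X) : Prop :=
  let: OperatorFamily T G le P := s in
  [/\ partially_ordered G le, up_directed G le & sigma_complete G le] /\
  (forall i, G i -> projection (P i)) /\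
  [/\ forall i, G i -> separable (range (P i)),
      forall i j, G i -> G j -> le i j ->
        P i = P i \o P j /\ P i = P j \o P i,
      forall (t : nat -> T) u, increasing G le t -> supremum G le t u ->
        range (P u) = closure (\bigcup_n range (P (t n))) &
      [set: X] = \bigcup_(i in G) range (P i)].

Definition induced_set (s : operator_family X) : set (X -> K^o) :=
  \bigcup_(i in dom s) [set d \o op s i | d in dual_space].

Definition restrict_family (s : operator_family X) (G' : set (idx s)) :=
  OperatorFamily G' (ord_rel s) (op s).

Definition subskeleton (s : operator_family X) (G' : set (idx s)) : Prop :=
  sigma_closed (dom s) (ord_rel s) G' /\ projectional_skeleton (restrict_family G').

Definition isomorphic_via (q p : operator_family X) (phi : idx q -> idx p) :=
  [/\ projectional_skeleton q, projectional_skeleton p,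
      set_bij (dom q) (dom p) phi,
      forall i j, dom q i -> dom q j -> (ord_rel q i j <-> ord_rel p (phi i) (phi j)) &
      forall i, dom q i -> op q i = op p (phi i)].

Definition isomorphic (q p : operator_family X) : Prop :=
  exists phi, @isomorphic_via q p phi.

Definition isomorphic_to_subskeleton (q s : operator_family X) : Prop :=
  exists G' : set (idx s), subskeleton G' /\ isomorphic q (restrict_family G').

Definition rich (FF : set (set X)) : Prop :=
  [/\ forall F, FF F -> closed_separable_subspace F,
      forall E, closed_separable_subspace E ->
        exists F, FF F /\ E `<=` F &
      forall F : nat -> set X, increasing FF subset F ->
        FF (closure (\bigcup_n F n))].

Definition by_inclusion (FF : set (set X)) (P : set X -> X -> X) :=
  OperatorFamily FF subset P.

Definition simple_skeleton (FF : set (set X)) (P : set X -> X -> X) : Prop :=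
  [/\ rich FF,
      forall F, FF F -> projection (P F) /\ range (P F) = F &
      forall E F, FF E -> FF F -> E `<=` F ->
        P E = P E \o P F /\ P E = P F \o P E].

(* [D] and [M] are intersected literally: [X] and [K] are sets through [cX]   *)
(* and [cK], and a functional is a set of ordered pairs.                      *)
Variables (cX : set_coding X) (cK : set_coding K).

Definition graph (d : X -> K^o) : zset :=
  replace cX (fun x => ordered_pair (cX x) (cK (d x))).

(* X_M, the closure of the intersection of X and M *)
Definition closure_cap (M : zset) : set X :=
  closure [set x | zmem (cX x) M].

(* the annihilator in X of the intersection of D and M *)
Definition cap_perp (D : set (X -> K^o)) (M : zset) : set X :=
  [set x | forall d, D d -> zmem (graph d) M -> d x = 0].

Definition canonical_projection (D : set (X -> K^o)) (M : zset) (P : X -> X) :=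
  [/\ projection P, range P = closure_cap M &
      P @^-1` [set 0] = cap_perp D M].

Definition admits_canonical_projection D M : Prop :=
  exists P, canonical_projection D M P.

(* P_M; meaningful when M admits a canonical projection, which is then unique *)
Definition canproj (D : set (X -> K^o)) (M : zset) : X -> X :=
  xget (idfun : X -> X) (canonical_projection D M).

Definition canproj_family (D : set (X -> K^o)) (MM : zset) :=
  OperatorFamily (elts MM) included (canproj D).

End Banach.

(* Main.v *)
(* Fix 1/(k+1)-separated maximal subsets A_k of X, put A = U_k A_k, and close *)
(* countable subsets of A under countably many operations: Skolem functions   *)
(* of all formulas (so that the models are elementary, Tarski-Vaught), and    *)
(* operations relating points of X, functionals in D and indices of all the   *)
(* skeletons s_n.  A point of A lying in X_M is within 1/(2(k+1)) of a point  *)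
(* of M, which determines it, so A meets X_M and M in the same set B; since M *)
(* is generated by B, X_M determines M and M |-> X_M is an order embedding.   *)
(* For each n the indices of s_n in M form a countable directed set; at its   *)
(* supremum t_n(M) the projection has range X_M and kernel the annihilator of *)
(* D cap M, hence does not depend on n.  The kernel is computed from the fact *)
(* that D cap M separates the points of X_M, because M is closed under a      *)
(* choice of norming functionals: some N bounds the norms of cofinally many   *)
(* projections of s_0, and composing these with Hahn-Banach functionals gives *)
(* elements of D.  The sets {t_n(M)} are then sigma-closed, and all the       *)
(* subskeletons they index are isomorphic to the family of the X_M.           *)

Require Import Defs.
From mathcomp Require Import all_boot all_order all_algebra.
From mathcomp Require Import all_classical all_reals all_analysis.
From mathcomp Require Import complex ring lra.

Set Implicit Arguments.
Unset Strict Implicit.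
Unset Printing Implicit Defensive.

Import Order.TTheory GRing.Theory Num.Theory.
Import numFieldNormedType.Exports.

Local Open Scope classical_set_scope.
Local Open Scope ring_scope.

(** * The Hahn-Banach theorem *)

(** A projection is determined by its range and kernel ([projection_eq]), and the range X_M and
    kernel (D ∩ M)_⊥ of a canonical projection mention no skeleton. So it is enough to find, for a
    rich supply of countable [M] and for every n, a projection of [s n] with this range and kernel:
    all the [s n] then agree there.

    When [M] is closed under suitable operations, its indices in [s n] form a countable directed
    set, and the projection at their least upper bound has range X_M ([adequate_lub]) and kernel (D
    ∩ M)_⊥ ([adequate_kernel]). The kernel is right because D ∩ M separates the points of X_M
    ([adequate_separates]); this rests on norming functionals in D with one common bound
    ([skeleton_norming]), hence on Hahn-Banach.

    For X_M to determine [M], only models generated by points of fixed separated nets are used: a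
    net point in X_M already lies in [M] ([net_points]). Such models are stable under increasing
    unions, which yields richness and sigma-closedness ([simultaneous_simple_skeleton]).
    Absoluteness is closure under further countably many operations, the Skolem functions
    ([skolem_closed_absolute]), so the construction takes an arbitrary family [G0] of operations as
    a parameter. *)

Section Sublinear.
Context {R : realType} {K : pzRingType} (emb : {rmorphism R -> K}) {V : lmodType K}.
Implicit Types (p q : V -> R) (x y : V).

(** Scalars act through [emb], so that a complex space can be treated as a real one. *)
Definition sublinear p :=
  (forall x y, p (x + y) <= p x + p y) /\
  (forall a x, 0 < a -> p (emb a *: x) = a * p x).

Lemma sublinear0 p : sublinear p -> p 0 = 0.
Proof.
by move=> [_ hom]; have := hom 2 0 (ltr0Sn _ _); rewrite scaler0 => ?; lra.
Qed.

Lemma sublinear_oppl p x : sublinear p -> - p (- x) <= p x.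
Proof.
by move=> ps; have := ps.1 x (- x); rewrite subrr sublinear0 // => ?; lra.
Qed.

(** The reverse inequality is the assumed one for the scalar [a^-1]. *)
Lemma sublinear_of_le p : (forall x y, p (x + y) <= p x + p y) ->
  (forall a x, 0 < a -> p (emb a *: x) <= a * p x) -> sublinear p.
Proof.
move=> padd phom; split=> // a x a0; apply/eqP; rewrite eq_le phom //=.
have := phom a^-1 (emb a *: x); rewrite invr_gt0 => /(_ a0).
rewrite scalerA -rmorphM mulVf ?gt_eqF// rmorph1 scale1r.
by rewrite mulrC ler_pdivlMr // mulrC.
Qed.

Lemma sublinear_inf_chain (F : set (V -> R)) p0 : F !=set0 ->
  (forall p, F p -> sublinear p /\ forall x, p x <= p0 x) ->
  (forall p q, F p -> F q -> (forall x, p x <= q x) \/ (forall x, q x <= p x)) ->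
  exists q, sublinear q /\ forall p x, F p -> q x <= p x.
Proof.
move=> [p1 Fp1] Fs Ftot; pose q x := inf [set p x | p in F].
have qlb x : has_lbound [set p x | p in F].
  exists (- p0 (- x)) => _ [p Fp <-]; have [ps ple] := Fs p Fp.
  by have := sublinear_oppl x ps; have := ple (- x); lra.
have qle p x : F p -> q x <= p x.
  by move=> Fp; apply: ge_inf => //; exists p.
have qge x c : (forall p, F p -> c <= p x) -> c <= q x.
  move=> h; apply: lb_le_inf; first by exists (p1 x), p1.
  by move=> _ [p Fp <-]; exact: h.
exists q; split=> //; apply: sublinear_of_le => [x y|a x a0].
  rewrite -lerBlDr; apply: (qge) => p Fp; rewrite lerBlDr -lerBlDl.
  apply: (qge) => p' Fp'; rewrite lerBlDl.
  (* In a chain the smaller of [p] and [p'] can serve for both summands. *)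
  have [h|h] := Ftot _ _ Fp Fp'.
  - by have := qle p (x + y) Fp; have := (Fs p Fp).1.1 x y; have := h y; lra.
  - by have := qle p' (x + y) Fp'; have := (Fs p' Fp').1.1 x y; have := h x; lra.
rewrite -ler_pdivrMl //. apply: (qge) => p Fp; rewrite ler_pdivrMl //.
by rewrite -((Fs p Fp).1.2 a x a0); exact: qle.
Qed.

(* Subtracting the direction [y] forces a minimal sublinear functional to be  *)
(* odd at [y], hence additive.                                                *)
Lemma sublinear_direction p y : sublinear p ->
  exists q, [/\ sublinear q, forall x, q x <= p x & q (- y) <= - p y].
Proof.
move=> ps; have [padd phom] := ps.
(* The value t = 0 gives [q <= p], and t = 1 at the point [- y] gives [q (- y) <= - p y]. *)
pose S x := [set p (x + emb t *: y) - t * p y | t in [set t | 0 <= t]].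
pose q x := inf (S x).
have phom0 t x : 0 <= t -> p (emb t *: x) = t * p x.
  rewrite le_eqVlt => /predU1P[<-|/phom//].
  by rewrite rmorph0 scale0r mul0r sublinear0.
have qlb x : has_lbound (S x).
  exists (- p (- x)) => _ [t t0 <-].
  have := padd (x + emb t *: y) (- x).
  by rewrite addrC addKr phom0 // => ?; lra.
have qle t x : 0 <= t -> q x <= p (x + emb t *: y) - t * p y.
  by move=> t0; apply: ge_inf => //; exists t.
have qge x c : (forall t, 0 <= t -> c <= p (x + emb t *: y) - t * p y) -> c <= q x.
  move=> h; apply: lb_le_inf; first by exists (p (x + emb 0 *: y) - 0 * p y), 0 => /=.
  by move=> _ [t t0 <-]; exact: h.
exists q; split.
- apply: sublinear_of_le => [x x'|a x a0].
    rewrite -lerBlDr; apply: (qge) => t t0; rewrite lerBlDr -lerBlDl.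
    apply: (qge) => t' t'0; rewrite lerBlDl.
    have := qle (t + t') (x + x') (addr_ge0 t0 t'0).
    rewrite rmorphD scalerDl addrACA.
    by have := padd (x + emb t *: y) (x' + emb t' *: y); lra.
  rewrite -ler_pdivrMl //; apply: (qge) => t t0; rewrite ler_pdivrMl //.
  have := qle (a * t) (emb a *: x) (mulr_ge0 (ltW a0) t0).
  by rewrite rmorphM -scalerA -scalerDr phom // mulrBr mulrA.
- by move=> x; have := qle 0 x (lexx _); rewrite rmorph0 scale0r addr0 mul0r subr0.
- have := qle 1 (- y) ler01.
  by rewrite rmorph1 scale1r addNr mul1r sublinear0 // sub0r.
Qed.

Lemma minimal_sublinear p0 : sublinear p0 ->
  exists q, [/\ sublinear q, forall x, q x <= p0 x &
    forall r, sublinear r -> (forall x, r x <= q x) -> r = q].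
Proof.
move=> p0s.
pose T := {q : V -> R | sublinear q /\ forall x, q x <= p0 x}.
pose Rel (a b : T) := `[< forall x, sval b x <= sval a x >].
have [||||[q [qs qle]] qmax] := @Zorn T Rel.
- by move=> t; apply/asboolP.
- move=> a b c /asboolP ab /asboolP bc; apply/asboolP => x.
  exact: le_trans (bc x) (ab x).
- move=> [a Pa] [b Pb] /asboolP /= ab /asboolP /= ba.
  have e : a = b by apply/funext => x; apply/eqP; rewrite eq_le ab ba.
  by subst b; congr exist; exact: Prop_irrelevance.
(* The order is reversed, so a chain is bounded by its infimum, and the empty chain by [p0]. *)
- move=> A Atot; have [A0|A0] := pselect (A !=set0); last first.
    have t0 : T by exists p0; split.
    by exists t0 => a Aa; case: A0; exists a.
  have [|||q [qs qle]] := @sublinear_inf_chain [set sval a | a in A] p0.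
  - by case: A0 => a Aa; exists (sval a), a.
  - by move=> _ [a Aa <-]; exact: (svalP a).
  - move=> _ _ [a Aa <-] [b Ab <-].
    by have [/asboolP|/asboolP] := Atot a b Aa Ab; [right|left].
  have qp : sublinear q /\ forall x, q x <= p0 x.
    split=> // x; case: A0 => a Aa; apply: (le_trans (qle (sval a) x _)).
      by exists a.
    exact: (svalP a).2.
  exists (exist _ q qp) => a Aa; apply/asboolP => x /=.
  by apply: qle; exists a.
exists q; split=> // r rs rle.
have rp : sublinear r /\ forall x, r x <= p0 x.
  by split=> // x; exact: le_trans (rle x) (qle x).
have /(_ _)/(congr1 sval)// := qmax (exist _ r rp).
by apply; apply/asboolP.
Qed.

(** Lower [p] in the direction [z], then take a minimal functional below. By minimality it equals
    each of its own directional lowerings, so it is odd, and an odd subadditive map is additive.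
    Oddness at [z] turns u(-z) <= -p(z) into the required equality. *)
Lemma sublinear_Hahn_Banach p z : sublinear p ->
  exists u : V -> R,
    [/\ forall x y, u (x + y) = u x + u y,
        forall a x, u (emb a *: x) = a * u x,
        forall x, u x <= p x & u z = p z].
Proof.
move=> ps; have [pz [pzs pzle pzz]] := sublinear_direction z ps.
have [u [us ule umin]] := minimal_sublinear pzs.
have uN x : u (- x) = - u x.
  have [r [rs rle rx]] := sublinear_direction x us.
  have e := umin r rs rle; apply/eqP; rewrite eq_le -{1}e rx /=.
  by have := sublinear_oppl x us; lra.
have uD x y : u (x + y) = u x + u y.
  apply/eqP; rewrite eq_le us.1 /=.
  by have := us.1 (- x) (- y); rewrite -opprD !uN; lra.
exists u; split=> //.
- move=> a x; case: (ltrgt0P a) => [a0|a0|->].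
  + exact: us.2.
  + have := us.2 (- a) x; rewrite oppr_gt0 => /(_ a0).
    by rewrite rmorphN scaleNr uN mulNr => /oppr_inj.
  + by rewrite rmorph0 scale0r mul0r sublinear0.
- by move=> x; exact: le_trans (ule x) (pzle x).
- apply/eqP; rewrite eq_le (le_trans (ule z) (pzle z)) /=.
  by have := ule (- z); rewrite uN; have := pzz; lra.
Qed.
End Sublinear.

Lemma real_Hahn_Banach_norm (R : realType) (X : normedModType R) (z : X) :
  exists f : X -> R^o, [/\ linear f, forall x, `|f x| <= `|x| & f z = `|z|].
Proof.
have ns : sublinear (idfun : R -> R) (fun x : X => `|x|).
  by split=> [x y|a x a0]; [exact: ler_normD | rewrite normrZ gtr0_norm].
have [u [uD uZ ule uz]] := sublinear_Hahn_Banach z ns.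
exists u; split=> // [a x y|x]; first by rewrite uD uZ.
have uN : u (- x) = - u x.
  by have := uZ (-1) x; rewrite /= scaleN1r mulN1r.
rewrite ler_norml ule andbT; have := ule (- x); rewrite uN normrN => ?.
lra.
Qed.

Lemma complex_Hahn_Banach_norm (R : realType) (X : normedModType R[i]) (z : X) :
  exists f : X -> R[i]^o, [/\ linear f, forall x, `|f x| <= `|x| & f z = `|z|].
Proof.
pose p (x : X) : R := complex.Re `|x|.
have pE x : (p x)%:C%C = `|x| by rewrite /p RRe_real // ger0_real.
have ps : sublinear (real_complex R) p.
  split=> [x y|a x a0].
    by have := ler_normD x y; rewrite -!pE -rmorphD lecR.
  apply: (@complexI R); rewrite pE normrZ rmorphM /= pE; congr (_ * _).
  by rewrite ger0_norm // ler0c ltW.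
have [u [uD uZ ule uz]] := sublinear_Hahn_Banach z ps.
have uN x : u (- x) = - u x.
  by have := uZ (-1) x; rewrite rmorphN1 scaleN1r mulN1r.
(* A complex-linear map is recovered from its real part [u] by Im f(x) = -u(ix). *)
pose f (x : X) : R[i]^o := Complex (u x) (- u ('i%C *: x)).
have fZ (a : R[i]) x : f (a *: x) = a * f x.
  have h c d : u ((Complex c d) *: x) = c * u x + d * u ('i%C *: x).
    rewrite (complexE (Complex c d)) /= scalerDl uD uZ; congr (_ + _).
    by rewrite mulrC -scalerA uZ.
  case: a => a b; rewrite /f (h a b) scalerA.
  have -> : 'i%C * Complex a b = Complex (- b) a.
    by apply/eqP; rewrite eq_complex /=; apply/andP; split; apply/eqP; ring.
  rewrite (h (- b) a).
  by apply/eqP; rewrite eq_complex /=; apply/andP; split; apply/eqP; ring.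
have fle x : `|f x| <= `|x|.
  have [->|fx0] := eqVneq (f x) 0; first by rewrite normr0.
  (* Rotating [x] by the unimodular [a] makes the value real, where the bound on [u] applies. *)
  pose a : R[i] := `|f x| / f x.
  have na : `|a| = 1 by rewrite normrM normrV ?unitfE // normr_id divff ?normr_eq0.
  have e : f (a *: x) = `|f x| by rewrite fZ /a divfK.
  have eu : (u (a *: x))%:C%C = `|f x|.
    by rewrite -e; have := ger0_Im (normr_ge0 (f x)); rewrite -e /f /= => ->.
  have ax : `|a *: x| = `|x| by rewrite normrZ na mul1r.
  by rewrite -eu -ax -pE lecR.
have fD x y : f (x + y) = f x + f y.
  by apply/eqP; rewrite eq_complex /f /= scalerDr !uD opprD !eqxx.
exists f; split=> // [a x y|]; first by rewrite fD fZ.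
have h := fle z.
(* The real part of [f z] already has modulus [|z|], which leaves no room for an imaginary part. *)
have h2 : - u ('i%C *: z) = 0.
  apply/eqP; rewrite -sqrf_eq0 eq_le sqr_ge0 andbT.
  have : `|f z| ^+ 2 <= `|z| ^+ 2 by rewrite ler_sqr ?nnegrE.
  by rewrite -add_Re2_Im2 -pE -rmorphXn lecR /= uz; lra.
by rewrite -pE /f h2 uz.
Qed.

Lemma Hahn_Banach_norm (K : numFieldType) (hK : real_or_complex K)
    (X : normedModType K) (z : X) :
  exists f : X -> K^o, [/\ linear f, forall x, `|f x| <= `|x| & f z = `|z|].
Proof.
case: hK => -[R e]; subst K; first exact: real_Hahn_Banach_norm.
exact: complex_Hahn_Banach_norm.
Qed.

Lemma real_or_complex_archimedean (K : numFieldType) (hK : real_or_complex K) (x : K) :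
  0 <= x -> exists n : nat, x < n%:R.
Proof.
case: hK => -[R e]; subst K => x0.
  by exists (Num.truncn x).+1; exact: truncnS_gt.
have xR : x = (complex.Re x)%:C%C by rewrite RRe_real // ger0_real.
have [n hn] : exists n : nat, complex.Re x < n%:R.
  exists (Num.truncn (complex.Re x)).+1; exact: truncnS_gt.
by exists n; rewrite xR -(rmorph_nat (real_complex R)) ltcR.
Qed.

Lemma real_or_complex_invn (K : numFieldType) (hK : real_or_complex K) (e : K) :
  0 < e -> exists k : nat, k.+1%:R^-1 < e.
Proof.
move=> e0; have [n hn] : exists n : nat, e^-1 < n%:R.
  by apply: real_or_complex_archimedean => //; rewrite invr_ge0 ltW.
exists n; rewrite invf_plt ?posrE //; apply: lt_trans hn _.
by rewrite ltr_nat.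
Qed.

(** * Projections and skeletons *)

Lemma countable_range T (A : set T) : countable A -> A !=set0 ->
  exists f : nat -> T, range f = A.
Proof.
move=> /pfcard_geP[->[]//|[f] _].
exists f; apply/seteqP; split=> [_ [n _ <-]|x Ax]; first exact: funS.
by have [n _ <-] := @surj _ _ _ _ f x Ax; exists n.
Qed.

Lemma closure_sub_closure (T : topologicalType) (A B : set T) :
  A `<=` closure B -> closure A `<=` closure B.
Proof.
move=> AB; rewrite (iffLR (closure_id (closure B)) (@closed_closure _ B)).
exact: closureS.
Qed.

Section Normed.
Context {K : numFieldType}.
Implicit Types X Y : normedModType K.

Lemma closure_normP X (A : set X) x :
  closure A x <-> forall e : K, 0 < e -> exists2 a, A a & `|x - a| < e.
Proof.
split=> [clA e e0|h B /nbhs_ballP[e /= e0 Be]].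
  have [a [Aa xa]] := clA _ (nbhsx_ballx x e e0).
  by exists a => //; rewrite -ball_normE in xa.
have [a Aa xa] := h e e0; exists a; split=> //; apply: Be.
by rewrite -ball_normE.
Qed.

Lemma norm_eq0_small X (x : X) (C : K) :
  0 < C -> (forall e, 0 < e -> `|x| <= C * e) -> x = 0.
Proof.
move=> C0 h; apply/eqP/contraT; rewrite -normr_gt0 => x0.
have /h : 0 < `|x| / (C * 2) by rewrite divr_gt0 // mulr_gt0.
have -> : C * (`|x| / (C * 2)) = `|x| / 2 by field; rewrite gt_eqF.
by rewrite ler_pdivlMr // mulr_natr mulr2n gerDl => /(lt_le_trans x0); rewrite ltxx.
Qed.

Lemma bounded_linear_gt0 X Y (f : X -> Y) : bounded_linear f ->
  exists2 C : K, 0 < C & forall x, `|f x| <= C * `|x|.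
Proof.
(* On a trivial space [C] may be any scalar, hence the absolute value; adding 1 makes it
   positive. *)
move=> [_ [C hC]]; exists (`|C| + 1) => [|x]; first by rewrite ltr_wpDl.
have Cx : 0 <= C * `|x| by exact: le_trans (hC x).
apply: le_trans (hC x) _; rewrite mulrDl mul1r -(ger0_norm Cx) normrM normr_id.
by rewrite lerDl.
Qed.

Lemma linear_fun_sub X Y (f : X -> Y) x y : linear f -> f (x - y) = f x - f y.
Proof. by move=> fl; rewrite addrC -scaleN1r fl scaleN1r addrC. Qed.

Lemma linear_fun0 X Y (f : X -> Y) : linear f -> f 0 = 0.
Proof. by move=> fl; rewrite -[0 in LHS](subrr 0) linear_fun_sub // subrr. Qed.

Lemma bounded_linear_comp X Y (Z : normedModType K) (f : Y -> Z) (g : X -> Y) :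
  bounded_linear f -> bounded_linear g -> bounded_linear (f \o g).
Proof.
move=> bf bg; split=> [a x y|]; first by rewrite /= bg.1 bf.1.
have [C C0 hC] := bounded_linear_gt0 bf; have [C' C'0 hC'] := bounded_linear_gt0 bg.
exists (C * C') => x; apply: le_trans (hC _) _.
by rewrite -mulrA ler_pM2l.
Qed.

Lemma bounded_linear_closure0 X Y (f : X -> Y) (A : set X) : bounded_linear f ->
  (forall x, A x -> f x = 0) -> forall x, closure A x -> f x = 0.
Proof.
move=> bf f0 x /closure_normP clx; have [C C0 hC] := bounded_linear_gt0 bf.
apply: (norm_eq0_small C0) => e /clx[a Aa xa].
rewrite -[f x]subr0 -(f0 a Aa) -linear_fun_sub; last exact: bf.1.
by apply: le_trans (hC _) _; rewrite ler_pM2l // ltW.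
Qed.

End Normed.

Section Projection.
Context {K : numFieldType} {X : completeNormedModType K}.
Implicit Types P Q : X -> X.

Lemma projection_rangeP P x : projection P -> range P x <-> P x = x.
Proof. by move=> [_ PP]; split=> [[y _ <-]//|<-]; exists x. Qed.

(** The bounded map P - id vanishes on the range, hence on its closure. *)
Lemma projection_range_closure P x : projection P -> closure (range P) x -> P x = x.
Proof.
move=> PP clx; apply/eqP; rewrite -subr_eq0; apply/eqP.
have bf : bounded_linear (fun y => P y - y).
  split=> [a y z|].
    by rewrite PP.1.1 scalerBr opprD addrACA.
  have [C _ hC] := bounded_linear_gt0 PP.1; exists (C + 1) => y.
  by rewrite mulrDl mul1r (le_trans (ler_normB _ _)) // lerD2r.
apply: (bounded_linear_closure0 bf _ clx) => y /projection_rangeP-> //.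
by rewrite subrr.
Qed.

Lemma projection_subspace P : projection P -> Defs.subspace (range P).
Proof.
move=> PP; have Pl := PP.1.1; split.
  by exists 0 => //; exact: linear_fun0.
move=> a _ _ [x _ <-] [y _ <-].
by apply/(projection_rangeP _ PP); rewrite Pl !PP.2.
Qed.

End Projection.

(** * Countable directed sets and cofinal chains *)

Section LeastUpperBound.
Context {I : Type}.
Implicit Types (G C : set I) (le : I -> I -> Prop).

Definition least_upper_bound G le C (u : I) :=
  [/\ G u, forall i, C i -> le i u &
      forall v, G v -> (forall i, C i -> le i v) -> le u v].

Lemma least_upper_bound_unique G le C u v : partially_ordered G le ->
  least_upper_bound G le C u -> least_upper_bound G le C v -> u = v.
Proof.
move=> [_ anti _] [Gu Cu minu] [Gv Cv minv].
by apply: anti => //; [exact: minu | exact: minv].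
Qed.

(** Enumerate [C] and bound each new element together with the previous term of the chain.
    Sigma-completeness, which speaks of sequences only, thereby reaches countable directed sets. *)
Lemma cofinal_chain G le C : partially_ordered G le -> C `<=` G ->
  countable C -> C !=set0 -> up_directed C le ->
  exists r, [/\ increasing C le r, (forall i, C i -> exists k, le i (r k))
    & forall v, G v -> (forall k, le (r k) v) -> forall i, C i -> le i v].
Proof.
move=> [refl _ trans] CG cC C0 dir.
have [c cE] := countable_range cC C0.
have Cc k : C (c k) by rewrite -cE; exists k.
have /choice[ub ubP] (ij : I * I) : exists k, C ij.1 -> C ij.2 ->
    [/\ C k, le ij.1 k & le ij.2 k].
  have [C1|] := pselect (C ij.1); last by exists (c 0%N).
  have [C2|] := pselect (C ij.2); last by exists (c 0%N).
  by have [k ?] := dir _ _ C1 C2; exists k.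
pose r := fix r k := if k is k'.+1 then ub (r k', c k) else c 0%N.
have Cr k : C (r k).
  by elim: k => [|k IH]; [exact: Cc | have [] := ubP (r k, c k.+1) IH (Cc _)].
have cof i : C i -> exists k, le i (r k).
  rewrite -cE => -[[|k] _ <-]; first by exists 0%N; exact/refl/CG/Cc.
  by exists k.+1; have [] := ubP (r k, c k.+1) (Cr k) (Cc _).
exists r; split=> //.
  by split=> // k; have [] := ubP (r k, c k.+1) (Cr k) (Cc _).
move=> v Gv rv i Ci; have [k ik] := cof i Ci.
by apply: trans ik (rv k) => //; exact: CG.
Qed.

End LeastUpperBound.

(** The definition destructs the record; this form applies to a variable [s]. *)
Lemma projectional_skeletonP (K : numFieldType) (X : completeNormedModType K)
    (s : operator_family X) :
  projectional_skeleton s <->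
  [/\ partially_ordered (dom s) (ord_rel s), up_directed (dom s) (ord_rel s) &
      sigma_complete (dom s) (ord_rel s)] /\
  (forall i, dom s i -> projection (op s i)) /\
  [/\ forall i, dom s i -> separable (range (op s i)),
      forall i j, dom s i -> dom s j -> ord_rel s i j ->
        op s i = op s i \o op s j /\ op s i = op s j \o op s i,
      forall (t : nat -> idx s) u, increasing (dom s) (ord_rel s) t ->
        Defs.supremum (dom s) (ord_rel s) t u ->
        range (op s u) = closure (\bigcup_n range (op s (t n))) &
      [set: X] = \bigcup_(i in dom s) range (op s i)].
Proof. by case: s. Qed.

(** * Suprema, factorisation and norming in one skeleton *)

Section Skeleton.
Context {K : numFieldType} {X : completeNormedModType K}.
Variable s : operator_family X.
Hypothesis hs : projectional_skeleton s.

Local Notation G := (dom s).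
Local Notation le := (ord_rel s).

Lemma skeleton_order : partially_ordered G le.
Proof. by have /projectional_skeletonP[[]] := hs. Qed.

Lemma skeleton_directed : up_directed G le.
Proof. by have /projectional_skeletonP[[]] := hs. Qed.

Lemma skeleton_complete : sigma_complete G le.
Proof. by have /projectional_skeletonP[[]] := hs. Qed.

Lemma skeleton_projection i : G i -> projection (op s i).
Proof. by have /projectional_skeletonP[_ [+ _]] := hs; exact. Qed.

Lemma skeleton_comp i j : G i -> G j -> le i j ->
  op s i = op s i \o op s j /\ op s i = op s j \o op s i.
Proof. by have /projectional_skeletonP[_ [_ [_ + _ _]]] := hs; exact. Qed.

Lemma skeleton_cover x : exists2 i, G i & op s i x = x.
Proof.
have /projectional_skeletonP[_ [_ [_ _ _ cov]]] := hs.
have : [set: X] x by []; rewrite cov => -[i Gi /projection_rangeP h].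
by exists i => //; apply: h; exact: skeleton_projection.
Qed.

Lemma skeleton_range_le i j : G i -> G j -> le i j ->
  range (op s i) `<=` range (op s j).
Proof.
move=> Gi Gj ij _ [x _ <-]; have [_ e] := skeleton_comp Gi Gj ij.
by exists (op s i x) => //; rewrite [in RHS]e.
Qed.

Lemma skeleton_dense i : G i ->
  exists q : nat -> X, (forall k, range (op s i) (q k)) /\
    range (op s i) `<=` closure (range q).
Proof.
have /projectional_skeletonP[_ [_ [sep _ _ _]]] := hs.
move=> Gi; have [A [cA AP PA]] := sep i Gi.
have P0 : range (op s i) (op s i 0) by exists 0.
have A0 : A !=set0 by have [a [Aa _]] := PA _ P0 _ (filterT); exists a.
have [q qE] := countable_range cA A0; exists q; split; last by rewrite qE.
by move=> k; apply: AP; rewrite -qE; exists k.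
Qed.

Lemma skeleton_range_closed i : G i -> closed_separable_subspace (range (op s i)).
Proof.
move=> Gi; have Pi := skeleton_projection Gi.
have /projectional_skeletonP[_ [_ [sep _ _ _]]] := hs.
split; [|exact: sep|exact: projection_subspace].
by move=> x /(projection_range_closure Pi)/(projection_rangeP _ Pi).
Qed.

Lemma skeleton_lub (C : set (idx s)) :
  C `<=` G -> countable C -> C !=set0 -> up_directed C le ->
  exists2 u, least_upper_bound G le C u &
    range (op s u) = closure (\bigcup_(i in C) range (op s i)).
Proof.
move=> CG cC C0 dir.
have [r [[Cr incr] cof ub]] := cofinal_chain skeleton_order CG cC C0 dir.
have rinc : increasing G le r by split=> // n; exact/CG.
have [u su] := skeleton_complete rinc; have [Gu ru minu] := su.
exists u; first by split=> // [|v Gv Cv]; [exact: ub | apply: minu => // n; exact: Cv].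
have /projectional_skeletonP[_ [_ [_ _ cl _]]] := hs; rewrite (cl _ _ rinc su).
congr (closure _); apply/seteqP; split=> x [j].
  by move=> _ Px; exists (r j).
move=> Cj Px; have [k jk] := cof j Cj; exists k => //.
by move: Px; apply: skeleton_range_le => //; exact: CG.
Qed.

Lemma skeleton_countable_ub (c : nat -> idx s) : (forall k, G (c k)) ->
  exists2 u, G u & forall k, le (c k) u.
Proof.
move=> Gc; have [refl _ trans] := skeleton_order.
have /choice[ub ubP] (ij : idx s * idx s) : exists k, G ij.1 -> G ij.2 ->
    [/\ G k, le ij.1 k & le ij.2 k].
  have [C1|] := pselect (G ij.1); last by exists (c 0%N).
  have [C2|] := pselect (G ij.2); last by exists (c 0%N).
  by have [k ?] := skeleton_directed C1 C2; exists k.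
pose r := fix r k := if k is k'.+1 then ub (r k', c k) else c 0%N.
have Gr k : G (r k).
  by elim: k => [|k IH]; [exact: Gc | have [] := ubP (r k, c k.+1) IH (Gc _)].
have [|u [Gu ru _]] := @skeleton_complete r.
  by split=> // k; have [] := ubP (r k, c k.+1) (Gr k) (Gc _).
exists u => // -[|k]; first exact: (ru 0%N).
apply: (trans _ (r k.+1)) => //.
by have [] := ubP (r k, c k.+1) (Gr k) (Gc _).
Qed.

Lemma induced_set_bounded d : induced_set s d -> bounded_linear d.
Proof.
move=> [i Gi [f bf <-]]; apply: bounded_linear_comp => //.
exact: (skeleton_projection Gi).1.
Qed.

Lemma induced_set_factor d : induced_set s d -> exists2 i, G i & d = d \o op s i.
Proof.
move=> [i Gi [f bf <-]]; exists i => //; apply/funext => x /=.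
by rewrite (skeleton_projection Gi).2.
Qed.

Lemma factor_le T (d : X -> T) i j : G i -> G j -> le i j ->
  d = d \o op s i -> d = d \o op s j.
Proof.
move=> Gi Gj ij dE; have dP x : d x = d (op s i x) by rewrite [in LHS]dE.
by apply/funext => x; rewrite /= [LHS]dP [RHS]dP [in LHS](skeleton_comp Gi Gj ij).1.
Qed.

(** Some [N] bounds the norms of cofinally many projections: otherwise pick for each [N] an index
    above which the bound [N] always fails; an upper bound of these indices carries a bounded
    projection, a contradiction. Composing a norm-attaining functional at [z] with such a projection
    fixing [z] gives [d]. *)
Lemma skeleton_norming (hK : real_or_complex K) :
  exists N : nat, forall z, exists d,
    [/\ induced_set s d, d z = `|z| & forall x, `|d x| <= N%:R * `|x|].
Proof.
suff [N hN] : exists N : nat, forall i, G i -> exists j,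
    [/\ G j, le i j & forall x, `|op s j x| <= N%:R * `|x|].
  exists N => z; have [i Gi iz] := skeleton_cover z.
  have [j [Gj ij jN]] := hN i Gi.
  have [f [fl fle fz]] := Hahn_Banach_norm hK z.
  have jz : op s j z = z.
    apply/projection_rangeP; first exact: skeleton_projection.
    by apply: (skeleton_range_le Gi) => //; exists z.
  exists (f \o op s j); split; last by move=> x; exact: le_trans (fle _) (jN x).
  - by exists j => //; exists f => //; split=> //; exists 1 => x; rewrite mul1r.
  - by rewrite /= jz.
apply: contrapT => /forallNP unb.
have /choice[c cP] N : exists i, G i /\ forall j, G j -> le i j ->
    ~ forall x, `|op s j x| <= N%:R * `|x|.
  apply: contrapT => h; apply: (unb N) => i Gi; apply: contrapT => h'.
  by apply: h; exists i; split=> // j Gj ij jN; apply: h'; exists j.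
have [u Gu cu] := skeleton_countable_ub (fun N => (cP N).1).
have [C C0 hC] := bounded_linear_gt0 (skeleton_projection Gu).1.
have [N CN] := real_or_complex_archimedean hK (ltW C0).
apply: ((cP N).2 u Gu (cu N)) => x; apply: le_trans (hC x) _.
by rewrite ler_wpM2r // ltW.
Qed.

End Skeleton.

Lemma projection_eq (K : numFieldType) (X : completeNormedModType K) (P Q : X -> X) :
  projection P -> projection Q -> range P = range Q ->
  P @^-1` [set 0] = Q @^-1` [set 0] -> P = Q.
Proof.
move=> Pproj Qproj rPQ kPQ; apply/funext => x.
have QP : Q (P x) = P x by apply/(projection_rangeP _ Qproj); rewrite -rPQ; exists x.
have : (P @^-1` [set 0]) (x - P x).
  by rewrite /= (linear_fun_sub _ _ Pproj.1.1) Pproj.2 subrr.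
rewrite kPQ /= (linear_fun_sub _ _ Qproj.1.1) QP => /eqP.
by rewrite subr_eq0 => /eqP.
Qed.

(** * Subskeletons and transport along order-isomorphisms *)

Section Isomorphism.
Context {K : numFieldType} {X : completeNormedModType K}.
Implicit Types p q s : operator_family X.

(** Suprema in a sigma-closed [G'] coincide with those in the whole index set, so the other axioms
    are inherited. *)
Lemma subskeleton_of_closed s (G' : set (idx s)) : projectional_skeleton s ->
  sigma_closed (dom s) (ord_rel s) G' -> up_directed G' (ord_rel s) ->
  (forall x, exists2 i, G' i & op s i x = x) -> subskeleton G'.
Proof.
move=> hs G'cl G'dir G'cov; have [G'G G'sup] := G'cl.
have [refl anti trans] := skeleton_order hs.
have sub_sup r u : increasing G' (ord_rel s) r ->
    Defs.supremum (dom s) (ord_rel s) r u -> Defs.supremum G' (ord_rel s) r u.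
  move=> rinc su; have [Gu ru umin] := su; split=> //; first exact: G'sup rinc su.
  by move=> v /G'G; exact: umin.
have incG r : increasing G' (ord_rel s) r -> increasing (dom s) (ord_rel s) r.
  by move=> [G'r rinc]; split=> // n; exact/G'G.
split=> //; apply/projectional_skeletonP; split; [split=> //|split; [|split]].
- split=> [i /G'G|i j /G'G ? /G'G|i j k /G'G ? /G'G ? /G'G];
    [exact: refl|exact: anti|exact: trans].
- move=> r rinc; have [u su] := skeleton_complete hs (incG _ rinc).
  by exists u; exact: sub_sup.
- by move=> i /G'G; exact: (skeleton_projection hs).
- by move=> i /G'G; have /projectional_skeletonP[_ [_ [+ _ _ _]]] := hs; exact.
- by move=> i j /G'G ? /G'G ?; exact: (skeleton_comp hs).
- move=> r u rinc [G'u ru umin]; have [u' su'] := skeleton_complete hs (incG _ rinc).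
  have [G'u' ru' umin'] := sub_sup _ _ rinc su'.
  have -> : u = u' by apply: anti; [exact: G'G|exact: G'G|exact: umin|exact: umin'].
  have /projectional_skeletonP[_ [_ [_ _ + _]]] := hs; apply => //.
  exact: incG.
- apply/seteqP; split=> // x _; have [i G'i ix] := G'cov x.
  by exists i => //; exists x.
Qed.

Lemma isomorphic_via_transport q p (phi : idx q -> idx p) :
  projectional_skeleton p -> set_bij (dom q) (dom p) phi ->
  (forall i j, dom q i -> dom q j ->
    (ord_rel q i j <-> ord_rel p (phi i) (phi j))) ->
  (forall i, dom q i -> op q i = op p (phi i)) -> isomorphic_via phi.
Proof.
move=> hp phi_bij phi_ord phi_op; split=> //.
have [phi_dom phi_inj phi_surj] := phi_bij.
have domP i : dom q i -> dom p (phi i) by exact: phi_dom.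
have [refl anti trans] := skeleton_order hp.
have sup_phi r u : (forall k, dom q (r k)) -> dom q u ->
    Defs.supremum (dom p) (ord_rel p) (phi \o r) (phi u) <->
    Defs.supremum (dom q) (ord_rel q) r u.
  move=> qr qu; split=> -[Gu ru umin]; split=> //.
  - by move=> n; apply/phi_ord => //; exact: ru.
  - move=> v qv rv; apply/phi_ord => //; apply: umin; first exact: domP.
    by move=> n; apply/phi_ord => //; exact: rv.
  - exact: domP.
  - by move=> n; apply/phi_ord => //; exact: ru.
  - move=> w /phi_surj[v qv <-] rv; apply/phi_ord => //; apply: umin => // n.
    by apply/phi_ord => //; exact: rv.
have inc_phi r : increasing (dom q) (ord_rel q) r ->
    increasing (dom p) (ord_rel p) (phi \o r).
  by move=> [qr rinc]; split=> n; [exact: domP | apply/phi_ord => //; exact: rinc].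
apply/projectional_skeletonP; split; [split|split; [|split]].
- split=> [i qi|i j qi qj|i j k qi qj qk].
  + by apply/phi_ord => //; exact/refl/domP.
  + move=> /phi_ord ij /phi_ord ji; apply: phi_inj; rewrite ?inE //.
    by apply: anti; [exact: domP|exact: domP|exact: ij|exact: ji].
  + move=> /phi_ord ij /phi_ord jk; apply/phi_ord => //.
    by apply: trans (ij _ _) (jk _ _) => //; exact: domP.
- move=> i j qi qj; have [_ [/phi_surj[k qk <-] ik jk]] :=
    skeleton_directed hp (domP _ qi) (domP _ qj).
  by exists k; split=> //; apply/phi_ord.
- move=> r rinc; have [w sw] := skeleton_complete hp (inc_phi _ rinc).
  have [/phi_surj[u qu uw] _ _] := sw; exists u; apply/sup_phi => //.
    exact: rinc.1.
  by rewrite uw.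
- by move=> i qi; rewrite phi_op //; exact/(skeleton_projection hp)/domP.
- move=> i qi; rewrite phi_op //.
  by have /projectional_skeletonP[_ [_ [+ _ _ _]]] := hp; apply; exact: domP.
- move=> i j qi qj /phi_ord ij; rewrite !phi_op //.
  by apply: (skeleton_comp hp); [exact: domP|exact: domP|exact: ij].
- move=> r u rinc su; have [qu _ _] := su; rewrite phi_op //.
  have /projectional_skeletonP[_ [_ [_ _ + _]]] := hp.
  move=> /(_ (phi \o r) (phi u) (inc_phi _ rinc)) ->.
    by congr (closure _); apply: eq_bigcupr => n _; rewrite phi_op //; exact: rinc.1.
  by apply/sup_phi => //; exact: rinc.1.
- apply/seteqP; split=> // x _; have [_ /phi_surj[i qi <-] ix] := skeleton_cover hp x.
  by exists i => //; exists x => //; rewrite phi_op.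
Qed.

Lemma isomorphic_trans q p s : isomorphic q p -> isomorphic p s -> isomorphic q s.
Proof.
move=> [phi [hq hp phi_bij phi_ord phi_op]] [psi [_ hs psi_bij psi_ord psi_op]].
exists (psi \o phi).
have domP i : dom q i -> dom p (phi i) by have [h _ _] := phi_bij; exact: h.
split=> //.
- have [phi_dom phi_inj phi_surj] := phi_bij.
  have [psi_dom psi_inj psi_surj] := psi_bij; split.
  + by move=> i /phi_dom/psi_dom.
  + move=> i j; rewrite !inE => qi qj ij; apply: phi_inj; rewrite ?inE //.
    by apply: psi_inj; rewrite ?inE //; exact: domP.
  + by move=> k /psi_surj[j /phi_surj[i qi <-] <-]; exists i.
- move=> i j qi qj; rewrite phi_ord // psi_ord //; exact: domP.
- by move=> i qi; rewrite phi_op // psi_op //; exact: domP.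
Qed.

End Isomorphism.

(** * Sets closed under countably many operations *)

Section ClosedUnder.
Context {U : Type}.
Implicit Types (G : seq U -> set U) (M B : set U) (l : seq U).

Fixpoint all_in M l : Prop := if l is x :: l' then M x /\ all_in M l' else True.

Definition closed_under G M := forall l, all_in M l -> G l `<=` M.

Lemma all_in_sub M M' l : M `<=` M' -> all_in M l -> all_in M' l.
Proof. by move=> MM'; elim: l => //= x l IH [/MM' ? /IH]. Qed.

Lemma closed_under_smallest G B : closed_under G (smallest (closed_under G) B).
Proof.
move=> l Bl x Gx M [GM BM]; apply: (GM l) => //.
by apply: all_in_sub Bl; exact: smallest_sub.
Qed.

(** Operations are finitary, so their arguments all lie in a single [M k]. *)
Lemma closed_under_bigcup G (M : nat -> set U) : (forall k, M k `<=` M k.+1) ->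
  (forall k, closed_under G (M k)) -> closed_under G (\bigcup_k M k).
Proof.
move=> incM GM l Ml x Gx.
suff [k Mkl] : exists k, all_in (M k) l by exists k => //; exact: (GM k l).
have homo k k' : (k <= k')%N -> M k `<=` M k'.
  elim: k' => [|k' IH]; first by rewrite leqn0 => /eqP ->.
  by rewrite leq_eqVlt => /predU1P[->//|/IH h]; exact: subset_trans (incM _).
elim: l Ml {x Gx} => [|x l IH] /=; first by exists 0%N.
move=> [[k _ Mkx] /IH[k' Mk'l]]; exists (maxn k k'); split.
  exact: homo (leq_maxl _ _) _ Mkx.
exact: all_in_sub (homo _ _ (leq_maxr _ _)) Mk'l.
Qed.

(* Elements of the hull are values of finite trees of operations, the leaves  *)
(* being in [B].                                                              *)
Lemma countable_smallest_closed_under G B : (forall l, countable (G l)) ->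
  countable B -> countable (smallest (closed_under G) B).
Proof.
move=> cG cB.
have [[u0]|noU] := pselect (inhabited U); last first.
  by rewrite [X in countable X](_ : _ = set0)// -subset0 => x; case: noU.
(* The default [u0] may put values outside the hull; only an inclusion of the hull in the range of
   [ev] is wanted. *)
have /choice[g gP] l : exists g : nat -> U, G l `<=` range g.
  have [->|/set0P l0] := eqVneq (G l) set0; first by exists (fun=> u0).
  by have [g <-] := countable_range (cG l) l0; exists g.
have [b bP] : exists b : nat -> U, B `<=` range b.
  have [->|/set0P B0] := eqVneq B set0; first by exists (fun=> u0).
  by have [b <-] := countable_range cB B0; exists b.
pose ev := fix ev (t : GenTree.tree nat) : U :=
  match t with
  | GenTree.Leaf n => b n
  | GenTree.Node n ts => g (map ev ts) n
  end.
have cev : countable (range ev).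
  exact: sub_countable (card_image_le _ _) (countableP _).
apply: sub_countable cev; apply: subset_card_le.
apply: smallest_sub => [l lev x /gP[n _ <-]|x /bP[n _ <-]]; last first.
  by exists (GenTree.Leaf n).
have [ts <-] : exists ts, map ev ts = l.
  elim: l lev => [|y l IH] /=; first by exists [::].
  by move=> [[t _ <-] /IH[ts <-]]; exists (t :: ts).
by exists (GenTree.Node n ts).
Qed.

End ClosedUnder.

(** At most one [x] is coded by [u], so an operation on [T] becomes a countable-valued operation on
    codes. *)
Lemma countable_fibre (T U V : Type) (f : T -> U) (W : T -> set V) (u : U) :
  injective f -> (forall x, countable (W x)) ->
  countable [set w | exists2 x, f x = u & W x w].
Proof.
move=> f_inj cW; have [[x <-]|nx] := pselect (exists x, f x = u).
  apply: sub_countable (cW x); apply: subset_card_le => w [x' /f_inj->].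
  by [].
rewrite [X in countable X](_ : _ = set0)// -subset0 => w [x fx _].
by apply: nx; exists x.
Qed.

Lemma countable_subsingleton T (A : set T) :
  (forall x y, A x -> A y -> x = y) -> countable A.
Proof.
move=> A1; have [->//|/set0P[a Aa]] := eqVneq A set0.
rewrite (_ : A = [set a])//; apply/seteqP; split=> [x Ax|x ->//].
exact: A1.
Qed.

Lemma countable_preimage (T U : Type) (f : T -> U) (M : set U) :
  injective f -> countable M -> countable (f @^-1` M).
Proof.
move=> f_inj; apply: sub_countable; apply: card_ge_preimage.
by move=> x y _ _; exact: f_inj.
Qed.

(** A point far from every element of a maximal separated set could be added to it. *)
Lemma maximal_separated_set (K : numFieldType) (X : normedModType K) (e : K) :
  0 < e -> exists A : set X,
    (forall a b, A a -> A b -> `|a - b| < e -> a = b) /\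
    forall x, exists2 a, A a & `|x - a| < e.
Proof.
move=> e0; have [F FP Ftot|A [Asep Amax]] := @Zorn_bigcup X
    [set A | forall a b, A a -> A b -> `|a - b| < e -> a = b].
  move=> a b [B FB Ba] [C FC Cb]; have [BC|CB] := Ftot _ _ FB FC.
  - exact: (FP _ FC) (BC _ Ba) Cb.
  - exact: (FP _ FB) Ba (CB _ Cb).
exists A; split=> // x; apply: contrapT => far.
have farA a : A a -> ~ (`|x - a| < e) by move=> Aa xa; apply: far; exists a.
apply: (Amax (x |` A)).
  split; first by move=> a Aa; right.
  move=> sub; apply: (farA x); first by apply: sub; left.
  by rewrite subrr normr0.
move=> a b [->|Aa] [->|Ab] //=; last exact: Asep.
- by move/farA: Ab => xb /xb.
- by rewrite distrC; move/farA: Aa => xb /xb.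
Qed.

(** * Countable sets closed under the operations of all skeletons *)

Section Adequate.
Context {K : numFieldType} {X : completeNormedModType K}.
Variable s : nat -> operator_family X.
Variable D : set (X -> K^o).
Context {U : Type}.
(* [U] stands for the universe of sets, but also has room for the indices of  *)
(* the skeletons, whose types need not be small enough to be coded as sets.   *)
Variables (eX : X -> U) (eD : (X -> K^o) -> U) (eG : forall n, idx (s n) -> U).
Arguments eG : clear implicits.
Variable A : nat -> set X.

Definition points (M : set U) : set X := eX @^-1` M.

Definition trace (M : set U) n : set (idx (s n)) :=
  [set i | dom (s n) i /\ M (eG n i)].

(** These are the consequences of elementarity that matter here. Rigidity serves to recover [M] from
    X_M; index, range and directedness give the range of the projection at the supremum;
    factorisation and norming give its kernel. *)
Record adequate (M : set U) : Prop := Adequate {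
  adequate_countable : countable M ;
  adequate0 : points M 0 ;
  adequate_rigid : forall x k a, points M x -> A k a ->
    `|x - a| < k.+1%:R^-1 / 2 -> points M a ;
  adequate_index : forall n x, points M x ->
    exists2 i, trace M i & op (s n) i x = x ;
  adequate_range : forall n i, trace M i ->
    range (op (s n) i) `<=` closure (points M) ;
  adequate_directed : forall n, up_directed (trace M (n := n)) (ord_rel (s n)) ;
  adequate_factor : forall n d, D d -> M (eD d) ->
    exists2 i, trace M i & d = d \o op (s n) i ;
  adequate_norming : exists N : nat, forall x, points M x -> exists d,
    [/\ D d, M (eD d), d x = `|x| & forall y, `|d y| <= N%:R * `|y|] }.

Hypothesis hK : real_or_complex K.
Hypothesis hs : forall n, projectional_skeleton (s n).
Hypothesis hD : forall n, induced_set (s n) = D.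
Hypothesis A_separated : forall k a b,
  A k a -> A k b -> `|a - b| < k.+1%:R^-1 -> a = b.
Hypotheses (eX_inj : injective eX) (eD_inj : injective eD)
  (eG_inj : forall n, injective (eG n)).

Lemma adequate_closure (G0 : seq U -> set U) : (forall l, countable (G0 l)) ->
  exists G : seq U -> set U, [/\ forall l, countable (G l),
    forall l, G0 l `<=` G l &
    forall M, countable M -> closed_under G M -> adequate M].
Proof.
move=> cG0.
(* Two net points of scale [k] within half the separation of [x] coincide, so [near x] has at most
   one point per scale. *)
pose near x := \bigcup_k [set b | A k b /\ `|x - b| < k.+1%:R^-1 / 2].
have c_near x : countable (near x).
  apply: bigcup_countable => // k _; apply: countable_subsingleton.
  move=> b c [Ab xb] [Ac xc]; apply: A_separated Ab Ac _.
  rewrite (splitr k.+1%:R^-1) -(subrKA x); apply: le_lt_trans (ler_normD _ _) _.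
  by rewrite distrC ltrD.
have exi n x : exists i, dom (s n) i /\ op (s n) i x = x.
  by have [i ? ?] := skeleton_cover (hs n) x; exists i.
pose iota n x := sval (cid (exi n x)).
have exq n i : exists q : nat -> X, dom (s n) i ->
    range (op (s n) i) `<=` closure (range q).
  have [Gi|nG] := pselect (dom (s n) i); last by exists (fun=> 0).
  by have [q [_ ?]] := skeleton_dense (hs n) Gi; exists q.
pose q n i := sval (cid (exq n i)).
have exub n (i j : idx (s n)) : exists k, dom (s n) i -> dom (s n) j ->
    [/\ dom (s n) k, ord_rel (s n) i k & ord_rel (s n) j k].
  have [Gi|] := pselect (dom (s n) i); last by exists i.
  have [Gj|] := pselect (dom (s n) j); last by exists i.
  by have [k ?] := skeleton_directed (hs n) Gi Gj; exists k.
pose ub n i j := sval (cid (exub n i j)).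
have exf n d : exists i, D d -> dom (s n) i /\ d = d \o op (s n) i.
  have [Dd|nD] := pselect (D d); last by have [i _] := exi n 0; exists i.
  move: Dd; rewrite -(hD n) => /(induced_set_factor (hs n))[i Gi dE].
  by exists i.
pose delta n d := sval (cid (exf n d)).
have [N /choice[f fP]] := skeleton_norming (hs 0%N) hK.
pose WX x : set U := eX @` near x `|`
  (range (fun n => eG n (iota n x)) `|` [set eD (f x)]).
pose WD d : set U := range (fun n => eG n (delta n d)).
pose WG n i : set U := range (fun k => eX (q n i k)).
pose W2 n (v : U) i : set U := [set w | exists2 j, eG n j = v & [set eG n (ub n i j)] w].
(* The codings may overlap, so [u] is read at once as a point, as a functional and as an index of
   each skeleton. *)
pose G l := G0 l `|` match l with
  | [::] => [set eX 0]
  | [:: u] => [set w | exists2 x, eX x = u & WX x w] `|`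
      ([set w | exists2 d, eD d = u & WD d w] `|`
       \bigcup_n [set w | exists2 i, eG n i = u & WG n i w])
  | [:: u; v] => \bigcup_n [set w | exists2 i, eG n i = u & W2 n v i w]
  | _ => set0
  end.
have c_range T (h : nat -> T) : countable (range h).
  exact: sub_countable (card_image_le _ _) (countableP _).
have cU T (B C : set T) : countable B -> countable C -> countable (B `|` C).
  move=> cB cC; rewrite -bigcup2E.
  by apply: bigcup_countable => // -[|[|k]] _ /=.
exists G; split=> [l|l|M cM GM]; last 1 first.
- have G1 u w : M u -> G [:: u] w -> M w by move=> Mu; exact: (GM [:: u]).
  have MX x w : M (eX x) -> WX x w -> M w.
    by move=> Mx xw; apply: (G1 _ _ Mx); right; left; exists x.
  have MG n i w : M (eG n i) -> WG n i w -> M w.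
    by move=> Mi iw; apply: (G1 _ _ Mi); right; right; right; exists n => //; exists i.
  split=> //.
  + by apply: (GM [::]) => //; right.
  + move=> x k b Mx Ab xb; apply: MX Mx _; left; exists b => //.
    by exists k.
  + move=> n x Mx; exists (iota n x); last exact: (svalP (cid (exi n x))).2.
    split; first exact: (svalP (cid (exi n x))).1.
    by apply: MX Mx _; right; left; exists n.
  + move=> n i [Gi Mi]; apply: subset_trans (svalP (cid (exq n i)) Gi) _.
    apply: closureS => _ [k _ <-].
    by apply: MG Mi _; exists k.
  + move=> n i j [Gi Mi] [Gj Mj]; have [Gk ik jk] := svalP (cid (exub n i j)) Gi Gj.
    exists (ub n i j); split=> //; split=> //.
    apply: (GM [:: eG n i; eG n j]) => //; right; exists n => //.
    by exists i => //; exists j.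
  + move=> n d Dd Md; have [Gi dE] := svalP (cid (exf n d)) Dd.
    exists (delta n d) => //; split=> //.
    by apply: (G1 _ _ Md); right; right; left; exists d => //; exists n.
  + exists N => x Mx; exists (f x); have [fD fx fN] := fP x; split=> //.
      by rewrite -(hD 0%N).
    by apply: MX Mx _; right; right.
- apply: (cU) => //; case: l => [|u [|v [|? ?]]] //.
  + apply: (cU); first apply: countable_fibre => // x.
      apply: (cU); last exact: cU.
      exact: sub_countable (card_image_le _ _) (c_near x).
    apply: (cU); first by apply: countable_fibre => // d; exact: c_range.
    apply: bigcup_countable => // n _.
    by apply: countable_fibre => // i; exact: c_range.
  + apply: bigcup_countable => // n _; apply: countable_fibre => // i.
    by apply: countable_fibre => // j; exact: countable1.
- by move=> w; left.
Qed.

(** Take [x] in [M] near [y] and [d] in D ∩ M norming [x]. Then |x| = |d(x - y)| <= N|x - y|, so |y|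
    <= (1 + N)|x - y|, which is arbitrarily small. *)
Lemma adequate_separates M y : adequate M -> closure (points M) y ->
  (forall d, D d -> M (eD d) -> d y = 0) -> y = 0.
Proof.
move=> adM /closure_normP cly y0; have [N hN] := adequate_norming adM.
have C0 : 0 < 1 + N%:R :> K by rewrite ltr_wpDr.
apply: (norm_eq0_small C0) => e e0; have [x Mx yx] := cly e e0.
have [d [Dd Md dx dN]] := hN x Mx.
have bd : bounded_linear d.
  by move: Dd; rewrite -(hD 0%N); exact: induced_set_bounded.
have x_le : `|x| <= N%:R * `|y - x|.
  have := dN (y - x); rewrite (linear_fun_sub _ _ bd.1) y0 // sub0r normrN dx.
  by rewrite normr_id.
rewrite -(subrK x y); apply: le_trans (ler_normD _ _) _.
apply: (le_trans (lerD (lexx _) x_le)).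
by rewrite -[X in X + _]mul1r -mulrDl ler_pM2l // ltW.
Qed.

Lemma adequate_lub M n : adequate M ->
  exists2 u, least_upper_bound (dom (s n)) (ord_rel (s n)) (trace M (n := n)) u &
    range (op (s n) u) = closure (points M).
Proof.
move=> adM; have [||||u ulub uE] := @skeleton_lub _ _ _ (hs n) (trace M (n := n)).
- by move=> i [].
- have cM := countable_preimage (eG_inj (n := n)) (adequate_countable adM).
  by apply: sub_countable cM; apply: subset_card_le => i [].
- have [i Mi _] := adequate_index adM n (adequate0 adM).
  by exists i.
- exact: adequate_directed.
exists u => //; rewrite uE; apply/seteqP; split.
  by apply: closure_sub_closure => x [i Mi]; exact: adequate_range.
apply: closureS => x Mx; have [i Mi ix] := adequate_index adM n Mx.
by exists i => //; exists x.
Qed.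

(** Each [d] in D ∩ M factors through a projection with index in [M], hence through the one at [u].
    So [d] takes the same value at [x] and at its projection, a point of X_M, where D ∩ M
    separates. *)
Lemma adequate_kernel M n u : adequate M ->
  least_upper_bound (dom (s n)) (ord_rel (s n)) (trace M (n := n)) u ->
  range (op (s n) u) = closure (points M) ->
  op (s n) u @^-1` [set 0] = [set x | forall d, D d -> M (eD d) -> d x = 0].
Proof.
move=> adM [Gu Mu _] uE.
have dE d : D d -> M (eD d) -> d = d \o op (s n) u.
  move=> Dd Md; have [i [Gi Mi] di] := adequate_factor adM n Dd Md.
  by apply: (factor_le (hs n) Gi Gu) di; exact: Mu.
apply/seteqP; split=> x /= h.
  move=> d Dd Md; rewrite (dE d Dd Md) /= h.
  move: Dd; rewrite -(hD 0%N) => /(induced_set_bounded (hs 0%N))[dl _].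
  exact: linear_fun0.
apply: (adequate_separates adM); first by rewrite -uE; exists x.
move=> d Dd Md; rewrite -[RHS](h d Dd Md) [in RHS](dE d Dd Md).
by [].
Qed.

Lemma net_points M k a : adequate M -> A k a -> closure (points M) a -> points M a.
Proof.
move=> adM Aa /closure_normP/(_ (k.+1%:R^-1 / 2))[|x Mx ax].
  by rewrite divr_gt0.
by apply: (adequate_rigid adM Mx Aa); rewrite distrC.
Qed.

End Adequate.

Lemma dense_nets (K : numFieldType) (X : normedModType K) :
  exists A : nat -> set X,
    (forall k a b, A k a -> A k b -> `|a - b| < k.+1%:R^-1 -> a = b) /\
    forall k x, exists2 a, A k a & `|x - a| < k.+1%:R^-1.
Proof.
have /choice[A AP] (k : nat) : exists A : set X,
    (forall a b, A a -> A b -> `|a - b| < k.+1%:R^-1 -> a = b) /\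
    forall x, exists2 a, A a & `|x - a| < k.+1%:R^-1.
  by apply: maximal_separated_set; rewrite invr_gt0.
by exists A; split=> k; have [] := AP k.
Qed.

(** * One family of models for all the skeletons *)

Section SimultaneousSkeleton.
Context {K : numFieldType} (hK : real_or_complex K) {X : completeNormedModType K}.
Variable s : nat -> operator_family X.
Hypothesis hs : forall n, projectional_skeleton (s n).
Variable D : set (X -> K^o).
Hypothesis hD : forall n, induced_set (s n) = D.
Context {U : Type}.
Variables (eX : X -> U) (eD : (X -> K^o) -> U) (eG : forall n, idx (s n) -> U).
Arguments eG : clear implicits.
Hypotheses (eX_inj : injective eX) (eD_inj : injective eD)
  (eG_inj : forall n, injective (eG n)).
Variable G0 : seq U -> set U.
Hypothesis cG0 : forall l, countable (G0 l).

(* [FF] consists of the fixed points of [F |-> closure (points (model F))]:   *)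
(* [F] determines its model, even though a model is not a function of the     *)
(* closure of its points in general.                                          *)
Lemma simultaneous_simple_skeleton :
  exists (FF : set (set X)) (P : set X -> X -> X) (model : set X -> set U),
    [/\ simple_skeleton FF P,
        forall n, isomorphic_to_subskeleton (by_inclusion FF P) (s n),
        forall F, FF F -> [/\ countable (model F), closed_under G0 (model F),
          F = closure (eX @^-1` model F) &
          P F @^-1` [set 0] =
            [set x | forall d, D d -> model F (eD d) -> d x = 0]] &
        forall E F, FF E -> FF F -> E `<=` F -> model E `<=` model F].
Proof.
have [A [Asep Anet]] := dense_nets X.
have [G [cG G0G G_adq]] :=
  adequate_closure hK hs hD Asep eX_inj eD_inj eG_inj cG0.
pose AA := \bigcup_k A k.
pose hull (B : set X) := smallest (closed_under G) (eX @` B).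
have hull_closed B : closed_under G (hull B) by exact: closed_under_smallest.
have hull_min B M : closed_under G M -> eX @` B `<=` M -> hull B `<=` M.
  exact: smallest_sub.
have hull_mono B C : B `<=` C -> hull B `<=` hull C.
  move=> BC; apply: hull_min => // _ [x Bx <-].
  by apply: sub_gen_smallest; exists x => //; exact: BC.
have sub_hull B : B `<=` eX @^-1` hull B.
  by move=> x Bx; apply: sub_gen_smallest; exists x.
pose model F := hull (AA `&` F).
pose FF := [set F | countable (AA `&` F) /\ F = closure (points eX (model F))].
have hull_adq B : countable B -> adequate D eX eD eG A (hull B).
  move=> cB; apply: G_adq => //; apply: countable_smallest_closed_under => //.
  exact: sub_countable (card_image_le _ _) cB.
have adq F : FF F -> adequate D eX eD eG A (model F) by move=> [? _]; exact: hull_adq.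
have AA_closure M : adequate D eX eD eG A M ->
    AA `&` closure (points eX M) = AA `&` points eX M.
  move=> adM; apply/seteqP; split=> x [[k _ Ax] Mx]; split; try by exists k.
    exact: net_points adM Ax Mx.
  exact: subset_closure.
(* A model generated by its own net points is recovered from the closure of its points. *)
have FF_intro M : countable M -> closed_under G M ->
    M `<=` hull (AA `&` points eX M) ->
    FF (closure (points eX M)) /\ model (closure (points eX M)) = M.
  move=> cM GM Mhull; have adM := G_adq M cM GM.
  have mE : model (closure (points eX M)) = M.
    rewrite /model AA_closure //; apply/seteqP; split=> //.
    by apply: hull_min => // _ [x [_ Mx] <-].
  split=> //; split; last by rewrite mE.
  rewrite AA_closure //; have := countable_preimage eX_inj cM.
  by apply: sub_countable; apply: subset_card_le => x [].
have model_points F : FF F -> AA `&` F = AA `&` points eX (model F).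
  by move=> FFF; rewrite -AA_closure; [rewrite -FFF.2 | exact: adq].
have model_mono E F : E `<=` F -> model E `<=` model F.
  by move=> EF; apply: hull_mono => x [? /EF].
(* Models commute with increasing unions; richness and sigma-closedness both come from this. *)
have FF_bigcup (F : nat -> set X) : increasing FF subset F ->
    FF (closure (\bigcup_n F n)) /\
    model (closure (\bigcup_n F n)) = \bigcup_n model (F n).
  move=> [FFF incF]; pose M := \bigcup_n model (F n).
  have -> : closure (\bigcup_n F n) = closure (points eX M).
    apply/seteqP; split; apply: closure_sub_closure.
      move=> x [n _]; rewrite (FFF n).2; apply: closureS => y My.
      by exists n.
    move=> x [n _ Mx]; apply: subset_closure; exists n => //.
    by rewrite (FFF n).2; exact: subset_closure.
  apply: FF_intro.
  - apply: bigcup_countable => // n _; exact: adequate_countable (adq _ (FFF n)).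
  - apply: closed_under_bigcup => n; last exact: hull_closed.
    exact: model_mono (incF n).
  - move=> u [n _]; apply: hull_mono; rewrite model_points //.
    by move=> x [AAx Mx]; split=> //; exists n.
have ext n F : exists u, FF F ->
    least_upper_bound (dom (s n)) (ord_rel (s n)) (trace eG (model F) (n := n)) u /\
    range (op (s n) u) = F.
  have [FFF|nF] := pselect (FF F); last first.
    by have [i _ _] := skeleton_cover (hs n) 0; exists i.
  have [u ulub uE] := adequate_lub hs eG_inj n (adq F FFF).
  by exists u => _; split=> //; rewrite uE -FFF.2.
pose t n F := sval (cid (ext n F)).
have tlub n F : FF F -> least_upper_bound (dom (s n)) (ord_rel (s n))
    (trace eG (model F) (n := n)) (t n F).
  by move=> FFF; have [] := svalP (cid (ext n F)) FFF.
have trange n F : FF F -> range (op (s n) (t n F)) = F.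
  by move=> FFF; have [] := svalP (cid (ext n F)) FFF.
have tdom n F : FF F -> dom (s n) (t n F) by move=> /(tlub n)[].
have tker n F : FF F -> op (s n) (t n F) @^-1` [set 0] =
    [set x | forall d, D d -> model F (eD d) -> d x = 0].
  move=> FFF; apply: (adequate_kernel hs hD (adq F FFF) (tlub n F FFF)).
  by rewrite trange // -FFF.2.
pose P F := op (s 0%N) (t 0%N F).
(* Neither the range nor the kernel depends on [n]: here the skeletons are matched. *)
have PE n F : FF F -> P F = op (s n) (t n F).
  move=> FFF; apply: projection_eq.
  - exact/(skeleton_projection (hs 0%N))/tdom.
  - exact/(skeleton_projection (hs n))/tdom.
  - by rewrite !trange.
  - by rewrite !tker.
have t_mono n E F : FF E -> FF F ->
    (E `<=` F <-> ord_rel (s n) (t n E) (t n F)).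
  move=> FFE FFF; split=> [EF|EF].
    have [_ _] := tlub n E FFE; apply; first exact: tdom.
    move=> i [Gi Mi]; have [_ + _] := tlub n F FFF; apply; split=> //.
    exact: model_mono EF _ Mi.
  rewrite -(trange n E FFE) -(trange n F FFF).
  by apply: (skeleton_range_le (hs n)) => //; exact: tdom.
have t_inj n E F : FF E -> FF F -> t n E = t n F -> E = F.
  by move=> FFE FFF e; rewrite -(trange n E FFE) e trange.
have richFF : rich FF.
  split=> [F FFF|E [_ [B [cB BE EB]] _]|F /FF_bigcup[]//].
  - by rewrite -(trange 0%N F FFF); apply: (skeleton_range_closed (hs 0%N)); exact: tdom.
  (* A dense sequence of [E] need not consist of net points, so each of its points is replaced by
     net approximations of all scales. *)
  - have /choice[a aP] (xk : X * nat) :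
        exists a, A xk.2 a /\ `|xk.1 - a| < xk.2.+1%:R^-1.
      by have [a ? ?] := Anet xk.2 xk.1; exists a.
    pose C := \bigcup_(x in B) range (fun k => a (x, k)).
    have cC : countable C.
      apply: bigcup_countable => // x _.
      exact: sub_countable (card_image_le _ _) (countableP _).
    have adC := hull_adq C cC.
    have C_AA : C `<=` AA `&` points eX (hull C).
      move=> c Cc; split; last exact: sub_hull.
      by case: Cc => x _ [k _ <-]; exists k => //; exact: (aP (x, k)).1.
    exists (closure (points eX (hull C))); split.
      have [|//] := FF_intro (hull C) (adequate_countable adC) (hull_closed C).
      exact: hull_mono.
    apply: subset_trans EB _; apply: closure_sub_closure => x Bx.
    apply/closure_normP => e e0; have [k ke] := real_or_complex_invn hK e0.
    exists (a (x, k)); last exact: lt_trans (aP (x, k)).2 ke.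
    by apply: sub_hull; exists x => //; exists k.
exists FF, P, model; split=> [|n|F FFF|E F _ _]; last exact: model_mono.
- split=> // [F FFF|E F FFE FFF EF].
    by split; [exact/(skeleton_projection (hs 0%N))/tdom|exact: trange].
  by apply: (skeleton_comp (hs 0%N)); [exact: tdom|exact: tdom|exact/t_mono].
- have sub : subskeleton (t n @` FF).
    apply: subskeleton_of_closed => //.
    + split=> [_ [F FFF <-]|r u [rFF rinc] [Gu ru umin]]; first exact: tdom.
      have /choice[F FP] k : exists F, FF F /\ t n F = r k.
        by have [F ? ?] := rFF k; exists F.
      have incF : increasing FF subset F.
        split=> k; first by have [] := FP k.
        by apply/(t_mono n); rewrite ?(FP _).2 //; exact: (FP _).1.
      have [FFu mu] := FF_bigcup F incF.
      exists (closure (\bigcup_k F k)) => //.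
      (* The indices in the union model are those in the models of the [F k], so their least upper
         bound is the supremum of [r]. *)
      apply: least_upper_bound_unique (skeleton_order (hs n)) (tlub n _ FFu) _.
      have [_ _ trans] := skeleton_order (hs n).
      split=> // [i|v Gv vub].
        rewrite /trace mu => -[Gi [k _ Mi]].
        apply: (trans _ (r k)) => //; rewrite -(FP k).2; first exact/tdom/(FP k).1.
        by have [_ + _] := tlub n _ (FP k).1; apply.
      apply: umin => // k; rewrite -(FP k).2.
      have [_ _] := tlub n _ (FP k).1; apply => // i [Gi Mi]; apply: vub.
      by rewrite /trace mu; split=> //; exists k.
    + move=> _ _ [E FFE <-] [F FFF <-].
      pose M := hull (AA `&` E `|` AA `&` F).
      have cEF : countable (AA `&` E `|` AA `&` F).
        rewrite -bigcup2E; apply: bigcup_countable => // -[|[|k]] _ //=.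
          exact: FFE.1.
        exact: FFF.1.
      have [|FFM mM] := FF_intro M (adequate_countable (hull_adq _ cEF)) (hull_closed _).
        apply: hull_mono => x EFx; split; first by case: EFx => -[].
        exact: sub_hull.
      have le_M H : FF H -> AA `&` H `<=` AA `&` E `|` AA `&` F ->
          ord_rel (s n) (t n H) (t n (closure (points eX M))).
        move=> FFH HEF; apply/t_mono => //; rewrite FFH.2; apply: closureS => x.
        exact: hull_mono HEF _.
      exists (t n (closure (points eX M))); split.
      - by exists (closure (points eX M)).
      - by apply: le_M => // x; left.
      - by apply: le_M => // x; right.
    + move=> x; have [i Gi ix] := skeleton_cover (hs n) x.
      have [_ /(_ _ (skeleton_range_closed (hs n) Gi))[F [FFF iF]] _] := richFF.
      exists (t n F); first by exists F.
      apply/projection_rangeP; first exact/(skeleton_projection (hs n))/tdom.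
      by rewrite trange //; apply: iF; exists x.
  exists (t n @` FF); split=> //; exists (t n); apply: isomorphic_via_transport.
  + exact: sub.2.
  + split=> [F FFF|E F|//]; first by exists F.
    by rewrite !inE; exact: t_inj.
  + exact: t_mono.
  + exact: PE.
- split; last by rewrite tker.
  + exact: adequate_countable (adq F FFF).
  + by move=> l Ml; apply: subset_trans (G0G l) _; exact: hull_closed.
  + exact: FFF.2.
Qed.

End SimultaneousSkeleton.

(** * Elementary submodels *)

Section Skolem.
Implicit Types (M Q : set zset) (e : nat -> zset) (phi p : formula) (l : seq zset).

Lemma countable_formula : countable [set: formula].
Proof.
pose enc := fix enc phi : GenTree.tree nat :=
  match phi with
  | Eq i j => GenTree.Node 0 [:: GenTree.Leaf i; GenTree.Leaf j]
  | In i j => GenTree.Node 1 [:: GenTree.Leaf i; GenTree.Leaf j]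
  | Not p => GenTree.Node 2 [:: enc p]
  | And p q => GenTree.Node 3 [:: enc p; enc q]
  | Or p q => GenTree.Node 4 [:: enc p; enc q]
  | Imp p q => GenTree.Node 5 [:: enc p; enc q]
  | Iff p q => GenTree.Node 6 [:: enc p; enc q]
  | Ex i p => GenTree.Node 7 [:: GenTree.Leaf i; enc p]
  | All i p => GenTree.Node 8 [:: GenTree.Leaf i; enc p]
  end.
have enc_inj : injective enc.
  elim=> [i j|i j|p IHp|p IHp q IHq|p IHp q IHq|p IHp q IHq|p IHp q IHq|i p IHp|i p IHp]
    [i' j'|i' j'|p'|p' q'|p' q'|p' q'|p' q'|i' p'|i' p'] //= [].
  all: try by [move=> -> -> | move=> /IHp-> | move=> /IHp-> /IHq->].
  - by move=> -> /IHp->.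
  - by move=> -> /IHp->.
apply/countable_injP; exists (pickle \o enc) => p q _ _ /=.
by move=> /(pcan_inj (@pickleK _))/enc_inj.
Qed.

Lemma holds_in_ext Q e e' phi : (forall i, i \in free_vars phi -> e i = e' i) ->
  (holds_in Q e phi <-> holds_in Q e' phi).
Proof.
elim: phi e e' => [i j|i j|p IHp|p IHp q IHq|p IHp q IHq|p IHp q IHq|p IHp q IHq|
  i p IHp|i p IHp] e e' /= ee'.
- by rewrite !ee' ?inE ?eqxx ?orbT.
- by rewrite !ee' ?inE ?eqxx ?orbT.
- by rewrite (IHp e e').
- by rewrite (IHp e e') ?(IHq e e') // => k kp; apply: ee'; rewrite mem_cat kp ?orbT.
- by rewrite (IHp e e') ?(IHq e e') // => k kp; apply: ee'; rewrite mem_cat kp ?orbT.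
- by rewrite (IHp e e') ?(IHq e e') // => k kp; apply: ee'; rewrite mem_cat kp ?orbT.
- by rewrite (IHp e e') ?(IHq e e') // => k kp; apply: ee'; rewrite mem_cat kp ?orbT.
- have ext a : holds_in Q (update e i a) p <-> holds_in Q (update e' i a) p.
    apply: IHp => k kp; rewrite /update; case: eqP => // /eqP ki.
    by apply: ee'; rewrite mem_filter ki.
  by split=> -[a [Qa /ext]]; exists a.
- have ext a : holds_in Q (update e i a) p <-> holds_in Q (update e' i a) p.
    apply: IHp => k kp; rewrite /update; case: eqP => // /eqP ki.
    by apply: ee'; rewrite mem_filter ki.
  by split=> h a /h/ext.
Qed.

Definition env (vars : seq nat) l : nat -> zset :=
  fun j => nth (zset_fam (of_void zset)) l (index j vars).

(* Junk (the empty set) if there is no witness.                               *)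
Definition skolem (i : nat) p l : zset :=
  if pselect (exists b, holds_in setT (update (env (free_vars (Ex i p)) l) i b) p)
    is left h then sval (cid h) else zset_fam (of_void zset).

Lemma skolemP i p e b : holds_in setT (update e i b) p ->
  holds_in setT (update e i (skolem i p (map e (free_vars (Ex i p))))) p.
Proof.
set l := map _ _ => eb.
have ext a : holds_in setT (update (env (free_vars (Ex i p)) l) i a) p <->
             holds_in setT (update e i a) p.
  apply: holds_in_ext => k kp; rewrite /update; case: eqP => // /eqP ki.
  have kE : k \in free_vars (Ex i p) by rewrite /= mem_filter ki.
  by rewrite /env (nth_map 0%N) ?index_mem // nth_index.
apply/ext; rewrite /skolem; case: pselect => [h|]; first exact: svalP (cid h).
by case; exists b; apply/ext.
Qed.

(* The Tarski-Vaught criterion. *)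
Lemma skolem_closed_absolute M :
  (forall i p l, all_in M l -> M (skolem i p l)) ->
  forall phi e, (forall i, i \in free_vars phi -> M (e i)) ->
    (holds_in M e phi <-> holds_in setT e phi).
Proof.
move=> skM.
have allM e vars : (forall i, i \in vars -> M (e i)) -> all_in M (map e vars).
  elim: vars => //= i vars IH eM; split; first by apply: eM; rewrite inE eqxx.
  by apply: IH => j jv; apply: eM; rewrite inE jv orbT.
have upM e i a p : (forall j, j \in free_vars (Ex i p) -> M (e j)) -> M a ->
    forall j, j \in free_vars p -> M (update e i a j).
  move=> eM Ma j jp; rewrite /update; case: eqP => // /eqP ji.
  by apply: eM; rewrite /= mem_filter ji.
elim=> [i j|i j|p IHp|p IHp q IHq|p IHp q IHq|p IHp q IHq|p IHp q IHq|
  i p IHp|i p IHp] e eM //=.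
- by rewrite IHp.
- by rewrite IHp ?IHq // => k kp; apply: eM; rewrite /= mem_cat kp ?orbT.
- by rewrite IHp ?IHq // => k kp; apply: eM; rewrite /= mem_cat kp ?orbT.
- by rewrite IHp ?IHq // => k kp; apply: eM; rewrite /= mem_cat kp ?orbT.
- by rewrite IHp ?IHq // => k kp; apply: eM; rewrite /= mem_cat kp ?orbT.
- split=> [[a [Ma h]]|[b [_ /skolemP h]]].
    by exists a; split=> //; exact: iffLR (IHp _ (upM e i a p eM Ma)) h.
  exists (skolem i p (map e (free_vars (Ex i p)))).
  have Msk : M (skolem i p (map e (free_vars (Ex i p)))) by apply: skM; exact: allM.
  by split=> //; exact: iffRL (IHp _ (upM e i _ p eM Msk)) h.
- split=> [h b _|h a Ma]; last by apply: iffRL (IHp _ (upM e i a p eM Ma)) (h a _).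
  (* A counterexample anywhere yields one in [M], through the Skolem function of [Not p]. *)
  apply: contrapT => nb.
  have := @skolemP i (Not p) e b nb; apply => /=.
  have Msk : M (skolem i (Not p) (map e (free_vars (All i p)))).
    by apply: skM; exact: allM.
  exact: iffLR (IHp _ (upM e i _ p eM Msk)) (h _ Msk).
Qed.

End Skolem.

(** * Functionals, countable sets and families of subspaces as sets *)

Section Coding.
Implicit Types x y z : zset.

Lemma zmem_unordered_pair x y z : zmem z (unordered_pair x y) <-> z = x \/ z = y.
Proof.
rewrite zmem_zset_fam; split=> [[[] ->]|[->|->]]; [by left|by right|by exists true|].
by exists false.
Qed.

Lemma ordered_pair_inj x y x' y' :
  ordered_pair x y = ordered_pair x' y' -> x = x' /\ y = y'.
Proof.
move=> e; have mem z : z = unordered_pair x x \/ z = unordered_pair x y <->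
    z = unordered_pair x' x' \/ z = unordered_pair x' y'.
  by rewrite -!zmem_unordered_pair -!/(ordered_pair _ _) e.
have sub a b c d : unordered_pair a b = unordered_pair c d ->
    (a = c \/ a = d) /\ (b = c \/ b = d).
  by move=> abcd; split; apply/zmem_unordered_pair; rewrite -abcd;
     apply/zmem_unordered_pair; [left | right].
have xx : x = x'.
  have /mem[/sub[[]//]|/esym/sub[[->//|->//]]] :
    unordered_pair x x = unordered_pair x x \/ unordered_pair x x = unordered_pair x y.
  by left.
split=> //; subst x'.
have h1 : y = x \/ y = y'.
  have /mem[/sub[_ []]|/sub[]//] : unordered_pair x y = unordered_pair x x \/
    unordered_pair x y = unordered_pair x y by right.
  - by left.
  - by left.
have h2 : y' = x \/ y' = y.
  have /mem[/sub[_ []]|/sub[]//] : unordered_pair x y' = unordered_pair x x \/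
    unordered_pair x y' = unordered_pair x y' by right.
  - by left.
  - by left.
by case: h1 h2 => [->|//] [->|->].
Qed.

Lemma graph_inj (K : numFieldType) (X : completeNormedModType K)
  (cX : set_coding X) (cK : set_coding K) : injective (graph cX cK).
Proof.
move=> d d' e; apply/funext => x.
have : elts (graph cX cK d) (ordered_pair (cX x) (cK (d x))).
  by rewrite elts_replace; exists x.
rewrite e elts_replace => -[x' _ /ordered_pair_inj[xx dd]].
by rewrite -(code_inj dd) (code_inj xx).
Qed.

Lemma countable_zset (C : set zset) : countable C -> exists y, elts y = C.
Proof.
move=> cC; have [->|/set0P C0] := eqVneq C set0.
  exists (zset_fam (of_void zset)); rewrite -subset0 => x /zmem_zset_fam[[]].
have [f <-] := countable_range cC C0; exists (zset_fam f).
apply/seteqP; split=> x; first by move=> /zmem_zset_fam[n ->]; exists n.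
by move=> [n _ <-]; apply/zmem_zset_fam; exists n.
Qed.

(** The type [T] may be too large to index a set; its subsets are therefore decoded from predicates
    on the small type [B] that indexes the carrier. *)
Lemma zset_image_of_subsets (T : Type) (c : set_coding T) (C : set (set T))
  (F : set T -> zset) : exists y, elts y = F @` C.
Proof.
have := carrierE c; rewrite -(zset_ofK (carrier c)).
case: (zrepr _) => B f cE.
pose dec (S : B -> Prop) : set T := [set x | exists2 b, S b & c x = zset_of (f b)].
exists (zset_fam (fun S : {S : B -> Prop | C (dec S)} => F (dec (sval S)))).
apply/seteqP; split=> z.
  by move=> /zmem_zset_fam[[S CS] ->]; exists (dec S).
move=> [E CE <-]; apply/zmem_zset_fam.
pose S b := exists2 x, E x & c x = zset_of (f b).
suff decS : dec S = E.
  have CS : C (dec S) by rewrite decS.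
  by exists (exist _ S CS); rewrite /= decS.
apply/seteqP; split=> x.
  by move=> [b [x' Ex' <-] xx']; rewrite (code_inj xx').
move=> Ex; have : elts (zset_of (Node f)) (c x) by rewrite cE; exists x.
by move=> /zmem_zset_of[b cb]; exists b => //; exists x.
Qed.

End Coding.

Lemma existT_nat_inj (T : nat -> Type) n : injective (existT T n).
Proof. by move=> x y; exact: existT_inj2. Qed.

(** The operations are the elements of [S] as constants and the Skolem functions of all formulas,
    which ignore the arguments lying in [V]. *)
Lemma closed_models_suitable (S : zset) (Phi : seq formula) (V : Type) :
  countable (elts S) ->
  exists G0 : seq (zset + V) -> set (zset + V), (forall l, countable (G0 l)) /\
    forall (M : set (zset + V)) (m : zset), closed_under G0 M ->
      elts m = inl @^-1` M -> suitable_model Phi S m.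
Proof.
move=> cS; pose lefts := pmap (fun u : zset + V => if u is inl z then Some z else None).
pose G0 l := inl @` elts S `|`
  [set inl (skolem ip.1 ip.2 (lefts l)) | ip in [set: nat * formula]]
  : set (zset + V).
exists G0; split=> [l|M m GM mE].
  rewrite /G0 -bigcup2E; apply: bigcup_countable => // -[|[|k]] _ //=.
    exact: sub_countable (card_image_le _ _) cS.
  apply: sub_countable (card_image_le _ _) _; rewrite -setXTT.
  by apply: countableX => //; exact: countable_formula.
split=> [x Sx|phi _ e eM].
  by rewrite mE; apply: (GM [::]) => //; left; exists x.
apply: skolem_closed_absolute => // i p l.
rewrite mE => lM; apply: (GM (map inl l)).
  by elim: l lM => //= x l IH [? /IH].
right; exists (i, p) => //=; congr (inl (skolem _ _ _)).
by rewrite /lefts; elim: l {lM} => //= x l ->.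
Qed.

Lemma canproj_eq (K : numFieldType) (X : completeNormedModType K)
    (cX : set_coding X) (cK : set_coding K) (D : set (X -> K^o)) (M : zset)
    (P : X -> X) :
  canonical_projection cX cK D M P -> canproj cX cK D M = P.
Proof.
move=> cP; rewrite /canproj.
have [Q_proj Qrange Qker] : canonical_projection cX cK D M
    (xget (idfun : X -> X) (canonical_projection cX cK D M)).
  by apply: xgetPex; exists P.
have [P_proj Prange Pker] := cP.
by apply: projection_eq; rewrite ?Qrange ?Prange ?Qker ?Pker.
Qed.

(** * The two instances of the construction *)

Theorem theorem19 (K : numFieldType) (hK : real_or_complex K)
    (X : completeNormedModType K)
    (s : nat -> operator_family X)
    (hs : forall n, projectional_skeleton (s n))
    (D : set (X -> K^o)) (hD : forall n, induced_set (s n) = D) :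
  (exists (FF : set (set X)) (P : set X -> X -> X),
     simple_skeleton FF P /\
     forall n, isomorphic_to_subskeleton (by_inclusion FF P) (s n))
  /\
  (forall (cX : set_coding X) (cK : set_coding K)
          (S : zset) (Phi : seq formula), countable (elts S) ->
     exists MM : zset,
       (forall M, zmem M MM ->
          [/\ countable (elts M), suitable_model Phi S M &
              admits_canonical_projection cX cK D M])
       /\
       (let FF := [set closure_cap cX M | M in elts MM] in
        rich FF /\
        exists P : set X -> X -> X,
          [/\ forall M, zmem M MM -> P (closure_cap cX M) = canproj cX cK D M,
              simple_skeleton FF P &
              isomorphic_via (q := canproj_family cX cK D MM)
                (p := by_inclusion FF P) (closure_cap cX)])
       /\
       (forall n, isomorphic_to_subskeleton (canproj_family cX cK D MM) (s n))).
Proof.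
pose index := {n : nat & idx (s n)}.
split=> [|cX cK S Phi cS].
  (* No set-theoretic coding of [X] is available here, so points, functionals and indices are kept
     as disjoint summands. *)
  have [||||FF [P [_ [simple iso _ _]]]] := @simultaneous_simple_skeleton K hK X s hs
    D hD (X + (X -> K^o) + index) (inl \o inl) (inl \o inr)
    (fun n i => inr (existT _ n i)) _ _ _ (fun=> set0).
  - by move=> x y [].
  - by move=> x y [].
  - by move=> n i j []; exact: existT_nat_inj.
  - by [].
  by exists FF, P.
have [G0 [cG0 G0_suitable]] := closed_models_suitable Phi index cS.
(* Points and functionals are now genuine sets, while indices stay in a separate summand; the
   suitable model is the set part of [model F]. *)
have [|||FF [P [model [simple iso modelP model_mono]]]] :=
  @simultaneous_simple_skeleton K hK X s hs D hD (zset + index)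
    (inl \o cX) (inl \o graph cX cK) (fun n i => inr (existT _ n i)) _ _ _ G0 cG0.
- by move=> x y [xy]; exact: code_inj xy.
- by move=> d d' [dd']; exact: graph_inj dd'.
- by move=> n i j []; exact: existT_nat_inj.
have /choice[m mP] (F : set X) : exists z, FF F -> elts z = inl @^-1` model F.
  have [FFF|nF] := pselect (FF F); last by exists S.
  have [cM _ _ _] := modelP F FFF.
  have [|z zE] := @countable_zset (inl @^-1` model F); last by exists z.
  by apply: countable_preimage cM => x y [].
have [MM MME] := zset_image_of_subsets cX FF m.
have capE F : FF F -> closure_cap cX (m F) = F.
  move=> FFF; have [_ _ FE _] := modelP F FFF; rewrite [RHS]FE.
  rewrite /closure_cap; congr (closure _); apply/seteqP; split=> x /=.
    by rewrite -[zmem _ _]/(elts (m F) (cX x)) mP.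
  by rewrite -[zmem _ _]/(elts (m F) (cX x)) mP.
have FFE : [set closure_cap cX M | M in elts MM] = FF.
  rewrite MME; apply/seteqP; split=> [_ [_ [F FFF <-] <-]|F FFF].
    by rewrite capE.
  by exists (m F); [exists F | exact: capE].
have [_ simpleP _] := simple.
have proj F : FF F -> canonical_projection cX cK D (m F) (P F).
  move=> FFF; have [Pproj Prange] := simpleP F FFF.
  have [_ _ _ Pker] := modelP F FFF; split=> //; first by rewrite capE.
  rewrite Pker; apply/seteqP; split=> x /= h d Dd Md; apply: h => //.
    by move: Md; rewrite -[zmem _ _]/(elts (m F) (graph cX cK d)) mP.
  by rewrite -[zmem _ _]/(elts (m F) (graph cX cK d)) mP.
have canE M : zmem M MM -> P (closure_cap cX M) = canproj cX cK D M.
  rewrite -[zmem _ _]/(elts MM M) MME => -[F FFF <-].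
  by rewrite capE // (canproj_eq (proj F FFF)).
have viaP : isomorphic_via (q := canproj_family cX cK D MM)
    (p := by_inclusion FF P) (closure_cap cX).
  apply: isomorphic_via_transport.
  - by have [G' [_ [phi []]]] := iso 0%N.
  - rewrite /= MME; split=> [_ [F FFF <-]|M N|F FFF].
    + by rewrite /= capE.
    + by rewrite !inE => -[F FFF <-] [E FFE' <-]; rewrite !capE // => ->.
    + by exists (m F); [exists F | exact: capE].
  (* One direction is monotonicity of the closure, the other is [model_mono]. *)
  - rewrite /= MME => _ _ [E FFE' <-] [F FFF <-]; rewrite !capE //.
    split=> [EF|EF x]; last first.
      by rewrite !mP //; exact: model_mono.
    rewrite -(capE E) // -(capE F) //; apply: closureS => x.
    exact: EF.
  - by move=> M MMM; rewrite /= canE.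
exists MM; split=> [M|]; first last.
  rewrite /= FFE; split.
    by split; [case: simple | exists P; split].
  move=> n; have [G' [sub isoG']] := iso n; exists G'; split=> //.
  by apply: isomorphic_trans isoG'; exists (closure_cap cX).
rewrite -[zmem _ _]/(elts MM M) MME => -[F FFF <-].
have [cM GM _ _] := modelP F FFF; split.
- by rewrite mP //; apply: countable_preimage cM => x y [].
- exact: G0_suitable GM (mP F FFF).
- by exists (P F); exact: proj.
Qed.
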